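(* Let $d\ge 3$, $\kappa\ge 1$, and let $(a(e);e\in\mathbb L^d)$ be i.i.d. random conductances on the edges of $\mathbb Z^d$ with $\kappa^{-1}\le a(e)\le\kappa$ almost surely. Let $C_0=32d\kappa^3$ and let $f_N$ be the effective conductance between opposite faces of $Q_N=\{1,\dots,N\}^d$ (defined in the context). Then for all $t\ge 0$ and $N\ge 1$, $$\mathbb P\big(|f_N-\mathbb E f_N|\ge t N^{(2-d)/2}\big)\le 4\exp\big(-t/\sqrt{\kappa C_0}\big)$$ and $$\mathrm{Var}(f_N)\le \kappa C_0 N^{2-d}.$$
   Context: $\mathbb L^d$ is the set of nearest-neighbour edges of $\mathbb Z^d$; $x\sim y$ means $|x-y|=1$ (Euclidean norm); $a(x,y)=a(y,x)$ is the conductance of the edge with endpoints $x\sim y$. $\mathbb P$ is the law of the conductances, with expectation $\mathbb E$ and variance $\mathrm{Var}$. $Q_N=\{1,\dots,N\}^d$, $\overline Q_N=\{0,\dots,N+1\}^d$, $\partial Q_N=\overline Q_N\setminus Q_N$; $x(1)$ is the first coordinate of $x$. $\mathcal V_N$ is the set of functions $u:\overline Q_N\to\mathbb R$ with $u=0$ on $\{x(1)=0\}\cap\partial Q_N$, $u=N+1$ on $\{x(1)=N+1\}\cap\partial Q_N$, and $u(x)=u(y)$ whenever $x\sim y$, $x\in\partial Q_N$ with $x(1)\notin\{0,N+1\}$, and $y\in Q_N$. $\mathcal E_N(u,v)=\sum a(x,y)(u(x)-u(y))(v(x)-v(y))$, the sum being over edges $\{x,y\}$ with $x\in Q_N$,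 $y\in\overline Q_N$, $x\sim y$, each edge counted once. $f_N=N^{-d}\mathcal E_N(v_N,v_N)=N^{-d}\inf\{\mathcal E_N(u,u):u\in\mathcal V_N\}$, where $v_N\in\mathcal V_N$ is the minimizer, i.e. the element of $\mathcal V_N$ with $\sum_{y\sim x}a(x,y)(v_N(x)-v_N(y))=0$ for all $x\in Q_N$ (unique up to its irrelevant values at vertices of $\partial Q_N$ having no neighbour in $Q_N$). *)

(* Defs.v *)
From HB Require Import structures.
From mathcomp Require Import all_boot all_order all_algebra.
From mathcomp Require Import finmap.
From mathcomp Require Import all_classical all_reals all_analysis.

Set Implicit Arguments.
Unset Strict Implicit.
Unset Printing Implicit Defensive.

Import Order.TTheory GRing.Theory Num.Theory.
Import numFieldNormedType.Exports.

Local Open Scope classical_set_scope.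
Local Open Scope ring_scope.

(* The lattice dimension is written d.+1 throughout, so that the first
   coordinate x(1) is always [x ord0]. *)
Notation lattice d := {ffun 'I_d.+1 -> int}.

Definition adj (d : nat) (x y : lattice d) : bool :=
  \sum_(i < d.+1) (x i - y i) ^+ 2 == 1.

(* An (unoriented) edge is the two-element set of its endpoints. *)
Definition edges (d : nat) : set {fset lattice d} :=
  [set e | exists x y : lattice d, adj x y /\ e = [fset x; y]%fset].

Section Probability.
Context {disp : measure_display} {T : measurableType disp} {R : realType}.
Context (P : probability T R) (I : choiceType).

Definition mutually_independent (J : set I) (X : I -> {RV P >-> R}) : Prop :=
  forall (S : {fset I}) (B : I -> set R),
    [set` S] `<=` J -> (forall i, measurable (B i)) ->
    P (\bigcap_(i in [set` S]) (X i @^-1` B i)) =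
    (\prod_(i <- S) P (X i @^-1` B i))%E.

Definition identically_distributed (J : set I) (X : I -> {RV P >-> R}) : Prop :=
  forall (i j : I) (B : set R), J i -> J j -> measurable B ->
    distribution P (X i) B = distribution P (X j) B.

End Probability.

(* {0, ..., N+1}^(d+1) as a finite type of its own; [to_lattice] below embeds
   it in Z^(d+1). *)
Notation Qbar d N := {ffun 'I_d.+1 -> 'I_N.+2}.

Section Box.
Context {d N : nat}.
Implicit Types x y : Qbar d N.

Definition to_lattice x : lattice d := [ffun i => (x i : nat)%:Z].

Definition inQ x : bool := [forall i, 0 < x i < N.+1]%N.

Definition in_bdQ x : bool := ~~ inQ x.

Definition box_adj x y : bool := adj (to_lattice x) (to_lattice y).

(* Each edge with an endpoint in Q_N is selected exactly once, as the pair
   (x, y) where y is x plus a unit vector. *)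
Definition oriented_edge (p : Qbar d N * Qbar d N) : bool :=
  [&& box_adj p.1 p.2, [forall i, p.1 i <= p.2 i]%N & inQ p.1 || inQ p.2].

End Box.

Section EffectiveConductance.
Context {R : realType} (d N : nat).

Definition admissible : set (Qbar d N -> R) := [set u |
  [/\ forall x, in_bdQ x -> x ord0 = 0%N :> nat -> u x = 0,
      forall x, in_bdQ x -> x ord0 = N.+1 :> nat -> u x = N.+1%:R &
      forall x y, box_adj x y -> in_bdQ x ->
        x ord0 <> 0%N :> nat -> x ord0 <> N.+1 :> nat -> inQ y -> u x = u y]].

Definition conductance (a : {fset lattice d} -> R) (x y : Qbar d N) : R :=
  a [fset to_lattice x; to_lattice y]%fset.

Definition energy (a : {fset lattice d} -> R) (u v : Qbar d N -> R) : R :=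
  \sum_(p : Qbar d N * Qbar d N | oriented_edge p)
    conductance a p.1 p.2 * (u p.1 - u p.2) * (v p.1 - v p.2).

(* The real infimum is the minimal energy as soon as the conductances are
   nonnegative; [inf] of a set not bounded below is 0 by convention. *)
Definition eff_conductance (a : {fset lattice d} -> R) : R :=
  N%:R ^- d.+1 * inf [set energy a u u | u in admissible].

End EffectiveConductance.

Definition f_ {disp : measure_display} {T : measurableType disp} {R : realType}
    {P : probability T R} {d : nat} (a : {fset lattice d} -> {RV P >-> R})
    (N : nat) (w : T) : R :=
  eff_conductance N (fun e => a e w).

Definition C0 {R : realType} (d : nat) (kappa : R) : R :=
  32 * d.+1%:R * kappa ^+ 3.

(* Main.v *)
Require Import Defs.
From HB Require Import structures.
From mathcomp Require Import all_boot all_order all_algebra.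
From mathcomp Require Import finmap.
From mathcomp Require Import all_classical all_reals all_analysis.
From mathcomp Require Import measurable_realfun ring lra zify.

Set Implicit Arguments.
Unset Strict Implicit.
Unset Printing Implicit Defensive.

Import Order.TTheory GRing.Theory Num.Theory.
Import numFieldNormedType.Exports.

Local Open Scope classical_set_scope.
Local Open Scope ring_scope.

(** Only the crudest consequence of the maximum principle is used: for a
    minimiser v of the energy, every increment of v along an edge is at most
    N+1, because v may be truncated to [0, N+1].

    Write D for the dimension and regard f as a function of the finitely many
    conductances of the box.  As an infimum of linear functionals of the
    conductances, f is concave: if the conductance of e alone changes from
    a(e) to a'(e), then f increases by at most N^-D (a'(e) - a(e)) (dv(e))^2,
    where v is a minimiser for the unchanged conductances.  One v serves for all
    edges e at once, and the linear function x(1) shows that its energy is at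
    most kappa (N+1) N^(D-1).  Hence the squares of these upper bounds on the
    increments have a sum of at most
      kappa^2 N^(-2D) (N+1)^2 kappa (kappa (N+1) N^(D-1)) <= 8 kappa^4 N^(2-D)
    whatever the configuration ([box_conductance_coord], with 9 in place of 8
    because only near-minimisers are used).

    For independent coordinates, such a deterministic bound c on the sum of
    the squares of the upward increments gives everything.  The Efron-Stein
    inequality bounds the variance by c ([variance_bound]).  Applied to
    exp(lambda f / 2) instead of f, it gives
      G(lambda) <= G(lambda/2)^2 + (lambda^2 c / 2) G(lambda)
    for the centred moment generating function G; iterating this down to tiny
    lambda gives G(lambda) <= exp(2 c lambda^2) as long as lambda^2 c <= 1/8 and
    lambda times the largest increment is at most 1/2 ([mgf_bound]).  Chernoff's
    bound at lambda = 1 / (sqrt(kappa C0) N^((2-D)/2)) is the exponential tail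
    ([two_sided_tail]).  Since 32 D kappa^4 >= 96 kappa^4 is much larger than
    8 kappa^4, constant factors may be lost on the way.

    That room allows a discretisation: each conductance is rounded to finitely
    many levels, so that the Efron-Stein argument takes place on a finite
    product space, where every expectation is a finite sum.  Independence
    enters through the probabilities of rectangles ([box_edges_independent]).  By Lipschitz
    continuity of f the rounding moves f by at most a prescribed eta, and the
    bounds for the rounded variable are carried over to f ([tail_transfer],
    [variance_transfer]).  The event in the tail bound must also be measurable,
    and the conductances are bounded only almost surely, so f is proved
    measurable for arbitrary real conductances ([measurable_eff_conductance]):
    the infimum may be taken over rational functions. *)

(** * The Efron-Stein inequality on a finite product space *)

Section FiniteProduct.
Context {R : realType} {I K : finType}.
Implicit Types (w : {ffun I -> K}) (g h : {ffun I -> K} -> R) (i j : I) (k l : K).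

Definition upd w i k : {ffun I -> K} := [ffun j => if j == i then k else w j].

Lemma upd_same w i k l : upd (upd w i k) i l = upd w i l.
Proof. by apply/ffunP => j; rewrite !ffunE; case: eqP. Qed.

Lemma upd_swap w i j k l : i != j ->
  upd (upd w i k) j l = upd (upd w j l) i k.
Proof.
move=> ij; apply/ffunP => m; rewrite !ffunE.
by case: (eqVneq m j) => // ->; rewrite eq_sym (negPf ij).
Qed.

Lemma upd_id w i : upd w i (w i) = w.
Proof. by apply/ffunP => j; rewrite ffunE; case: eqP => // ->. Qed.

Variable mu : I -> K -> R.
Hypothesis mu_ge0 : forall i k, 0 <= mu i k.
Hypothesis mu_sum1 : forall i, \sum_k mu i k = 1.

Definition weight w : R := \prod_i mu i (w i).

Definition mean g : R := \sum_w weight w * g w.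

(** The conditional expectation given all coordinates but [i]. *)
Definition avg i g w : R := \sum_k mu i k * g (upd w i k).

Definition cvar i g w : R := avg i (fun v => g v ^+ 2) w - avg i g w ^+ 2.

Lemma weight_ge0 w : 0 <= weight w.
Proof. exact: prodr_ge0. Qed.

Lemma weight_upd w i k : weight (upd w i k) * mu i (w i) = weight w * mu i k.
Proof.
rewrite /weight (bigD1 i) //= [in RHS](bigD1 i) //= ffunE eqxx.
rewrite (eq_bigr (fun j => mu j (w j))); last first.
  by move=> j ji; rewrite ffunE (negPf ji).
ring.
Qed.

Lemma mean_cst (c : R) : mean (fun=> c) = c.
Proof.
rewrite /mean -big_distrl /= (_ : \sum_w _ = 1) ?mul1r // /weight.
rewrite -(bigA_distr_bigA (fun i k => mu i k)) /=.
by rewrite big1.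
Qed.

Lemma meanD g h : mean (fun w => g w + h w) = mean g + mean h.
Proof. by rewrite -big_split /=; apply: eq_bigr => w _; rewrite mulrDr. Qed.

Lemma meanZ c g : mean (fun w => c * g w) = c * mean g.
Proof. by rewrite /mean big_distrr; apply: eq_bigr => w _ /=; rewrite mulrCA. Qed.

Lemma mean_le g h : (forall w, g w <= h w) -> mean g <= mean h.
Proof. by move=> gh; apply: ler_sum => w _; apply: ler_wpM2l; rewrite ?weight_ge0. Qed.

Lemma eq_mean g h : (forall w, g w = h w) -> mean g = mean h.
Proof. by move=> gh; apply: eq_bigr => w _; rewrite gh. Qed.

Lemma mean_ge0 g : (forall w, 0 <= g w) -> 0 <= mean g.
Proof. by move=> g0; apply: sumr_ge0 => w _; apply: mulr_ge0; rewrite ?weight_ge0. Qed.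

Lemma meanB g h : mean (fun w => g w - h w) = mean g - mean h.
Proof.
rewrite meanD -[in RHS]mulN1r -meanZ; congr (_ + _).
by apply: eq_mean => w; rewrite mulN1r.
Qed.

Lemma mean_sum (J : finType) (G : J -> {ffun I -> K} -> R) :
  mean (fun w => \sum_j G j w) = \sum_j mean (G j).
Proof.
rewrite /mean exchange_big; apply: eq_bigr => w _ /=.
by rewrite big_distrr.
Qed.

(** Resampling coordinate [i] is reversible: [(w, l) |-> (upd w i l, w i)] is an
    involution that preserves the product weight. *)
Lemma mean_pair i (r : {ffun I -> K} -> {ffun I -> K} -> R) :
  mean (fun w => \sum_l mu i l * r w (upd w i l)) =
  mean (fun w => \sum_l mu i l * r (upd w i l) w).
Proof.
rewrite /mean.
under eq_bigr do rewrite big_distrr.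
under [RHS]eq_bigr do rewrite big_distrr.
rewrite /= !pair_big /=.
pose s (p : {ffun I -> K} * K) := (upd p.1 i p.2, p.1 i).
have sK : involutive s.
  move=> [w k]; rewrite /s /= upd_same upd_id.
  by rewrite ffunE eqxx.
rewrite (reindex_inj (inv_inj sK)) /=; apply: eq_bigr => -[w k] _ /=.
by rewrite mulrA weight_upd upd_same upd_id mulrA.
Qed.

Lemma mean_avg i g : mean (avg i g) = mean g.
Proof.
rewrite (mean_pair i (fun _ v => g v)); apply: eq_mean => w.
by rewrite -big_distrl /= mu_sum1 mul1r.
Qed.

Lemma avg_avg i g w k : avg i g (upd w i k) = avg i g w.
Proof. by apply: eq_bigr => l _; rewrite upd_same. Qed.

Lemma avg_sqr_le i g w : avg i g w ^+ 2 <= avg i (fun v => g v ^+ 2) w.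
Proof.
have : 0 <= \sum_k mu i k * (g (upd w i k) - avg i g w) ^+ 2.
  by apply: sumr_ge0 => k _; rewrite mulr_ge0 ?sqr_ge0.
rewrite (eq_bigr (fun k => mu i k * g (upd w i k) ^+ 2 +
  (- 2 * avg i g w * (mu i k * g (upd w i k)) + avg i g w ^+ 2 * mu i k))); last first.
  by move=> k _; ring.
rewrite !big_split /= -!big_distrr /= mu_sum1 -/(avg i g w).
rewrite -/(avg i (fun v => g v ^+ 2) w); nra.
Qed.

Lemma cvar_centered i g w (c : R) :
  cvar i g w = avg i (fun v => (g v - c) ^+ 2) w - (avg i g w - c) ^+ 2.
Proof.
rewrite /cvar {3}/avg (eq_bigr (fun k => mu i k * g (upd w i k) ^+ 2 +
  (- 2 * c * (mu i k * g (upd w i k)) + c ^+ 2 * mu i k))); last first.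
  by move=> k _; ring.
rewrite !big_split /= -!big_distrr /= mu_sum1 -/(avg i g w).
rewrite -/(avg i (fun v => g v ^+ 2) w); ring.
Qed.

(** Averages over different coordinates commute, so [avg i] acts under the
    square that defines the conditional variance, and Jensen's inequality applies. *)
Lemma cvar_avg_le i j g w : i != j -> cvar j (avg i g) w <= avg i (cvar j g) w.
Proof.
move=> ij.
have swap h v : avg j (avg i h) v = avg i (avg j h) v.
  rewrite /avg; under eq_bigr do rewrite big_distrr.
  under [RHS]eq_bigr do rewrite big_distrr.
  rewrite exchange_big /=; apply: eq_bigr => k _; apply: eq_bigr => l _.
  by rewrite mulrCA upd_swap // eq_sym.
have E v : cvar j g v = avg j (fun u => (g u - avg j g u) ^+ 2) v.
  rewrite (cvar_centered j g v (avg j g v)) subrr expr0n subr0.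
  by apply: eq_bigr => k _; rewrite avg_avg.
have -> : avg i (cvar j g) w = avg j (avg i (fun u => (g u - avg j g u) ^+ 2)) w.
  by rewrite swap; apply: eq_bigr => k _; rewrite E.
have -> : cvar j (avg i g) w =
    avg j (fun u => (avg i (fun v => g v - avg j g v) u) ^+ 2) w.
  rewrite (cvar_centered j _ w (avg j (avg i g) w)) subrr expr0n subr0.
  apply: eq_bigr => k _; congr (_ * _ ^+ 2).
  rewrite {4}/avg (eq_bigr (fun l => mu i l * g (upd (upd w j k) i l) -
    mu i l * avg j g (upd (upd w j k) i l))); last by move=> l _; rewrite mulrBr.
  by rewrite sumrB; congr (_ - _); rewrite -[RHS]/(avg i (avg j g) (upd w j k)) -swap avg_avg.
by apply: ler_sum => k _; apply: ler_wpM2l; rewrite ?mu_ge0 ?avg_sqr_le.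
Qed.

Definition avgs (s : seq I) g := foldl (fun h i => avg i h) g s.

Lemma mean_avgs s g : mean (avgs s g) = mean g.
Proof. by elim: s g => //= i s IH g; rewrite IH mean_avg. Qed.

Lemma avgs_upd s g j w k :
  (j \in s) || [forall v, forall l, g (upd v j l) == g v] ->
  avgs s g (upd w j k) = avgs s g w.
Proof.
elim: s g => [g /forallP /(_ w) /forallP /(_ k) /eqP //|i s IH g /= H].
apply: IH; case: (eqVneq j i) H => [->|ji] /= H.
  by apply/orP; right; apply/forallP => v; apply/forallP => l; rewrite avg_avg.
rewrite inE (negPf ji) /= in H; case/orP: H => [->//|H].
apply/orP; right; apply/forallP => v; apply/forallP => l; apply/eqP.
rewrite /avg; apply: eq_bigr => m _; rewrite upd_swap //.
by have /forallP/(_ (upd v i m))/forallP/(_ l)/eqP -> := H.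
Qed.

(** Averaging over every coordinate leaves a constant, which keeps the mean. *)
Lemma avgs_enum g w : avgs (enum I) g w = mean g.
Proof.
rewrite -(mean_avgs (enum I)) -[LHS]mean_cst; apply: eq_mean => v.
set h := avgs _ _.
have hupd j k u : h (upd u j k) = h u by apply: avgs_upd; rewrite mem_enum.
(* [mix] passes from [w] to [v] one coordinate at a time. *)
pose mix (s : seq I) := [ffun j => if j \in s then v j else w j].
have hmix s : h (mix s) = h w.
  elim: s => [|j s IH]; first by congr h; apply/ffunP => j; rewrite ffunE.
  rewrite -IH -(hupd j (v j) (mix s)); congr h; apply/ffunP => i.
  by rewrite !ffunE inE; case: eqP => // ->.
by rewrite -(hmix (enum I)); congr h; apply/ffunP => i; rewrite ffunE mem_enum.
Qed.

(** Averaging the coordinates out one at a time telescopes the variance; the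
    step that averages coordinate [i] costs the conditional variance of the
    current function, which earlier averages can only have decreased. *)
Lemma efron_stein_avgs (s : seq I) g : uniq s ->
  mean (fun w => g w ^+ 2) - mean (fun w => avgs s g w ^+ 2) <=
  \sum_(i <- s) mean (cvar i g).
Proof.
elim: s g => [|i s IH] g /=; first by rewrite big_nil subrr.
case/andP=> nis us; rewrite big_cons.
have -> : mean (cvar i g) = mean (fun w => g w ^+ 2) - mean (fun w => avg i g w ^+ 2).
  by rewrite /cvar meanB mean_avg.
have H : \sum_(j <- s) mean (cvar j (avg i g)) <= \sum_(j <- s) mean (cvar j g).
  rewrite big_seq [leRHS]big_seq; apply: ler_sum => j js.
  rewrite -(mean_avg i (cvar j g)); apply: mean_le => w; apply: cvar_avg_le.
  by apply: contraNneq nis => ->.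
have := IH (avg i g) us; lra.
Qed.

Lemma efron_stein g :
  mean (fun w => g w ^+ 2) - mean g ^+ 2 <= \sum_i mean (cvar i g).
Proof.
have := efron_stein_avgs g (enum_uniq I).
rewrite [X in _ -> _ <= X](_ : _ = \sum_(i <- enum I) mean (cvar i g)); last first.
  by rewrite big_enum.
rewrite (eq_mean (g := fun w => avgs (enum I) g w ^+ 2) (h := fun=> mean g ^+ 2)) ?mean_cst // => w.
by rewrite avgs_enum.
Qed.

Lemma cvar_sym i g w : 2 * cvar i g w =
  \sum_k \sum_l mu i k * mu i l * (g (upd w i k) - g (upd w i l)) ^+ 2.
Proof.
rewrite (eq_bigr (fun k => mu i k * (avg i (fun v => g v ^+ 2) w) +
   (- 2 * avg i g w * (mu i k * g (upd w i k)) + mu i k * g (upd w i k) ^+ 2))).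
  rewrite !big_split /= -!big_distrr -big_distrl /= mu_sum1 -/(avg i g w).
  rewrite -/(avg i (fun v => g v ^+ 2) w) /cvar; ring.
move=> k _; rewrite (eq_bigr (fun l => mu i k * (mu i l * g (upd w i l) ^+ 2) +
  (- 2 * (mu i k * g (upd w i k)) * (mu i l * g (upd w i l)) +
   mu i k * g (upd w i k) ^+ 2 * mu i l))); last by move=> l _; ring.
rewrite !big_split /= -!big_distrr /= mu_sum1 -/(avg i g w).
rewrite -/(avg i (fun v => g v ^+ 2) w); ring.
Qed.

(** The conditional variance is half the expected square of the difference of
    two independent resamplings; the two halves of the symmetric bound have the
    same mean. *)
Lemma mean_cvar_le i g (r : {ffun I -> K} -> {ffun I -> K} -> R) :
  (forall w l, (g (upd w i l) - g w) ^+ 2 <= r w (upd w i l) + r (upd w i l) w) ->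
  mean (cvar i g) <= mean (fun w => \sum_l mu i l * r w (upd w i l)).
Proof.
move=> H; rewrite -(mean_avg i (fun w => \sum_l _)).
apply: mean_le => w; rewrite -(ler_pM2l (x := 2)) // cvar_sym.
have -> : avg i (fun v => \sum_l mu i l * r v (upd v i l)) w =
    \sum_k \sum_l mu i k * mu i l * r (upd w i k) (upd w i l).
  apply: eq_bigr => k _; rewrite big_distrr; apply: eq_bigr => l _ /=.
  by rewrite upd_same mulrA.
rewrite mulr2n mulrDl mul1r [X in _ <= _ + X]exchange_big /= -big_split /=.
apply: ler_sum => k _; rewrite -big_split; apply: ler_sum => l _ /=.
have := H (upd w i l) k; rewrite !upd_same => /(ler_wpM2l (mulr_ge0 (mu_ge0 i k) (mu_ge0 i l))).
by move=> /le_trans -> //; rewrite le_eqVlt; apply/orP; left; apply/eqP; ring.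
Qed.

End FiniteProduct.

(** * Exponential concentration from one-sided increments *)

Section ExpBounds.
Context {R : realType}.
Implicit Types x y z q : R.

Lemma expR_le_inv x : x < 1 -> expR x <= (1 - x)^-1.
Proof.
move=> x1; have := expR_ge1Dx (- x); rewrite expRN => H.
have x1' : 0 < 1 - x by lra.
by rewrite -[leLHS]invrK lef_pV2 // posrE ?invr_gt0 ?expR_gt0.
Qed.

Lemma expR_le_quad x : x <= 2^-1 -> expR x <= 1 + x + 2 * x ^+ 2.
Proof.
move=> hx; have x1 : x < 1 by lra.
apply: (le_trans (expR_le_inv x1)).
rewrite -[leLHS]mul1r ler_pdivrMr; last by lra.
have : 0 <= x ^+ 2 * (1 - 2 * x) by rewrite mulr_ge0 ?sqr_ge0 //; lra.
lra.
Qed.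

Lemma inv_le_expR q : 0 <= q <= 2^-1 -> (1 - q)^-1 <= expR (2 * q).
Proof.
move=> /andP[q0 q1]; have q1' : 0 < 1 - q by lra.
rewrite -[leRHS]invrK -expRN lef_pV2 ?posrE ?expR_gt0 //.
apply: (le_trans (expR_le_inv _)); first by lra.
rewrite opprK invf_ple ?posrE; [|nra|lra].
by rewrite -[(1 - q)^-1]mul1r ler_pdivrMr; nra.
Qed.

Lemma expR_diff_le x y : x <= y -> expR y - expR x <= (y - x) * expR y.
Proof.
move=> xy; have := expR_ge1Dx (x - y); rewrite expRD expRN => H.
have E := expR_gt0 y; have : (1 + (x - y)) * expR y <= expR x.
  by move: H; rewrite -(ler_pM2r E) mulfVK ?gt_eqF.
nra.
Qed.

Lemma expR_diff_sqr_le x y z : `|x - y| <= z ->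
  (expR y - expR x) ^+ 2 <= (y - x) ^+ 2 * expR (2 * (x + z)).
Proof.
move=> hz; have [xz yx] : y <= x + z /\ x <= x + z.
  by move: hz; rewrite ler_norml => /andP[]; split; lra.
have -> : (y - x) ^+ 2 * expR (2 * (x + z)) = (`|y - x| * expR (x + z)) ^+ 2.
  by rewrite exprMn -expRM_natl real_normK ?num_real.
rewrite -[leLHS]real_normK ?num_real // lerXn2r ?nnegrE ?mulr_ge0 ?expR_ge0 //.
have [xy|yx'] := leP x y.
  rewrite !ger0_norm ?subr_ge0 ?ler_expR //.
  apply: (le_trans (expR_diff_le xy)).
  by rewrite ler_wpM2l ?subr_ge0 ?ler_expR.
rewrite !(distrC y, distrC (expR y)) !ger0_norm ?subr_ge0 ?ler_expR ?(ltW yx') //.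
apply: (le_trans (expR_diff_le (ltW yx'))).
by rewrite ler_wpM2l ?subr_ge0 ?ler_expR // ltW.
Qed.

End ExpBounds.

Section ProductConcentration.
Context {R : realType} {I K : finType}.
Variable mu : I -> K -> R.
Hypothesis mu_ge0 : forall i k, 0 <= mu i k.
Hypothesis mu_sum1 : forall i, \sum_k mu i k = 1.
Variables (F : {ffun I -> K} -> R) (b c : R).
Hypothesis F_incr : forall w, exists D : I -> R,
  (forall i l, F (upd w i l) - F w <= D i) /\ \sum_i D i ^+ 2 <= c.
Hypothesis F_bdd : forall w i l, F (upd w i l) - F w <= b.

Let c_ge0 (w : {ffun I -> K}) : 0 <= c.
Proof.
have [D [_ /(le_trans _)]] := F_incr w; apply.
by apply: sumr_ge0 => i _; exact: sqr_ge0.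
Qed.

(** By reversibility each pair of configurations that differ in one coordinate
    may be charged to the one with the smaller value of [F].  So a bound on the
    upward increments of [F] suffices, and this is what concavity provides; the
    factor [rho] is then evaluated at the point where the increments are
    controlled. *)
Lemma efron_stein_one_sided (g rho : {ffun I -> K} -> R) :
  (forall w, 0 <= rho w) ->
  (forall w i l, F w <= F (upd w i l) ->
     (g (upd w i l) - g w) ^+ 2 <= rho w * (F (upd w i l) - F w) ^+ 2) ->
  mean mu (fun w => g w ^+ 2) - mean mu g ^+ 2 <= c * mean mu rho.
Proof.
move=> rho0 H.
pose r w v := rho w * (Num.max 0 (F v - F w)) ^+ 2.
apply: (le_trans (efron_stein mu_ge0 mu_sum1 g)).
have r0 w v : 0 <= r w v by rewrite mulr_ge0 ?sqr_ge0.
apply: (@le_trans _ _ (\sum_i mean mu (fun w => \sum_l mu i l * r w (upd w i l)))).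
  apply: ler_sum => i _; apply: mean_cvar_le => // w l.
  have [le|/ltW le] := leP (F w) (F (upd w i l)).
    apply: (le_trans (H _ _ _ le)); rewrite -[leLHS]addr0 lerD ?r0 //.
    by rewrite /r max_r ?subr_ge0.
  have := H (upd w i l) i (w i); rewrite upd_same upd_id => /(_ le).
  rewrite -sqrrN opprB => /le_trans -> //; rewrite -[leLHS]add0r lerD ?r0 //.
  by rewrite /r max_r ?subr_ge0.
rewrite -mean_sum -meanZ; apply: mean_le => // w.
have [D [HD Dc]] := F_incr w.
rewrite mulrC; apply: (le_trans _ (ler_wpM2l (rho0 w) Dc)).
rewrite big_distrr; apply: ler_sum => i _ /=.
rewrite -[leRHS]mul1r -(mu_sum1 i) big_distrl; apply: ler_sum => l _.
rewrite ler_wpM2l // /r ler_wpM2l //.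
have D0 : 0 <= D i by have := HD i (w i); rewrite upd_id subrr.
by rewrite lerXn2r ?nnegrE // ?le_max ?lexx // ge_max D0 HD.
Qed.

Lemma variance_bound :
  mean mu (fun w => (F w - mean mu F) ^+ 2) <= c.
Proof.
have -> : mean mu (fun w => (F w - mean mu F) ^+ 2) =
  mean mu (fun w => F w ^+ 2) - mean mu F ^+ 2.
  transitivity (mean mu (fun w => F w ^+ 2 +
    (- 2 * mean mu F * F w + mean mu F ^+ 2))).
    by apply: eq_mean => w; ring.
  by rewrite !meanD meanZ mean_cst //; ring.
have := @efron_stein_one_sided F (fun=> 1) _ _; rewrite mean_cst // mulr1; apply => //.
by move=> w i l _; rewrite mul1r.
Qed.

Let G lam := mean mu (fun w => expR (lam * (F w - mean mu F))).

(** The Efron-Stein inequality for the exponential of [lam / 2 * F], whose square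
    is the exponential of [lam * F]. *)
Lemma mgf_recursion (lam : R) : `|lam| * b <= 2^-1 -> 
  G lam <= G (lam / 2) ^+ 2 + (lam ^+ 2 * c / 2) * G lam.
Proof.
move=> lb; pose g w := expR (lam / 2 * (F w - mean mu F)).
pose rho w := lam ^+ 2 / 2 * expR (lam * (F w - mean mu F)).
have rho0 w : 0 <= rho w by rewrite mulr_ge0 ?expR_ge0 // divr_ge0 ?sqr_ge0.
have := @efron_stein_one_sided g rho rho0 _.
have -> : mean mu (fun w => g w ^+ 2) = G lam.
  by apply: eq_mean => w; rewrite -expRM_natl; congr expR; field.
rewrite meanZ -/(G lam) -/(G (lam / 2)) => H.
suff : G lam - G (lam / 2) ^+ 2 <= c * (lam ^+ 2 / 2 * G lam).
  by rewrite lerBlDl => /le_trans -> //; rewrite lerD2l le_eqVlt; apply/orP; left; apply/eqP; field.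
apply: H => w i l le.
have Fb := F_bdd w i l.
have dF : 0 <= F (upd w i l) - F w by rewrite subr_ge0.
apply: (le_trans (expR_diff_sqr_le (z := `|lam| * b / 2) _)).
  rewrite -mulrBr normrM opprB addrA subrK distrC (ger0_norm dF).
  rewrite normrM (@ger0_norm _ 2^-1) // mulrAC.
  by rewrite ler_wpM2r // ler_wpM2l.
have e2 : expR (`|lam| * b) <= 2.
  apply: (@le_trans _ _ (expR 2^-1)); first by rewrite ler_expR.
  apply: (le_trans (expR_le_inv _)); first by lra.
  by rewrite -[leLHS]mul1r ler_pdivrMr; lra.
rewrite /rho; set X := F w - _; set E := expR (lam * X).
have -> : expR (2 * (lam / 2 * X + `|lam| * b / 2)) = E * expR (`|lam| * b).
  by rewrite -expRD; congr expR; field.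
have -> : lam / 2 * (F (upd w i l) - mean mu F) - lam / 2 * X =
    lam / 2 * (F (upd w i l) - F w) by rewrite /X; field.
have : 0 <= lam ^+ 2 * (F (upd w i l) - F w) ^+ 2 * E * (2 - expR (`|lam| * b)).
  apply: mulr_ge0; last by rewrite subr_ge0.
  by apply: mulr_ge0; rewrite ?expR_ge0 // -exprMn sqr_ge0.
have -> : (lam / 2 * (F (upd w i l) - F w)) ^+ 2 =
    lam ^+ 2 * (F (upd w i l) - F w) ^+ 2 / 4 by field.
lra.
Qed.

(** The exponent [2 * c * lam ^+ 2] is stable under the recursion: at [lam / 2] it
    contributes [c * lam ^+ 2] after squaring, and the loss [(1 - q)^-1] with
    [q = lam ^+ 2 * c / 2] contributes at most [2 * q = c * lam ^+ 2].  After
    enough halvings the second-order expansion of the exponential and the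
    variance bound start the induction. *)
Lemma mgf_bound (lam0 lam : R) : lam0 * b <= 2^-1 -> lam0 ^+ 2 * c <= 8^-1 ->
  `|lam| <= lam0 -> 0 <= b -> 
  mean mu (fun w => expR (lam * (F w - mean mu F))) <= expR (2 * c * lam ^+ 2).
Proof.
rewrite -/(G lam) => hb hc hl b0.
have lam00 : 0 <= lam0 by exact: le_trans hl.
pose B := \sum_w `|F w - mean mu F|.
have B0 : 0 <= B by apply: sumr_ge0.
have FB w : `|F w - mean mu F| <= B.
  by rewrite /B (bigD1 w) //= lerDl sumr_ge0.
have [n hn] : exists n, `|lam| * B <= 2 ^+ n / 2.
  exists (Num.bound (`|lam| * B * 2)).
  rewrite ler_pdivlMr // ltW //; apply: (lt_le_trans (archi_boundP _)).
    by rewrite !mulr_ge0.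
  by rewrite -natrX ler_nat ltnW // ltn_expl.
elim: n lam hn hl => [|n IH] lam hn hl.
  have : G lam <= mean mu (fun w => 1 + (lam * (F w - mean mu F) +
      2 * lam ^+ 2 * (F w - mean mu F) ^+ 2)).
    apply: mean_le => // w; rewrite addrA -mulrA -exprMn; apply: expR_le_quad.
    apply: (le_trans (ler_norm _)); rewrite normrM.
    rewrite expr0 mul1r in hn; apply: le_trans hn.
    by rewrite ler_wpM2l ?FB.
  move=> /le_trans -> //; rewrite !meanD !meanZ mean_cst // meanB mean_cst //.
  rewrite subrr mulr0 add0r; apply: (le_trans _ (expR_ge1Dx _)).
  by rewrite lerD2l mulrAC ler_wpM2r ?sqr_ge0 // ler_wpM2l ?variance_bound.
have l2 : lam ^+ 2 <= lam0 ^+ 2.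
  by rewrite -[lam ^+ 2]real_normK ?num_real // lerXn2r ?nnegrE.
have [w0 _|no] := pickP (fun _ : {ffun I -> K} => true); last first.
  by rewrite /G /mean big_pred0 ?expR_ge0.
have c0 := c_ge0 w0.
have lb : `|lam| * b <= 2^-1 by apply: le_trans hb; rewrite ler_wpM2r.
have rec := mgf_recursion lb.
have nl2 : `|lam / 2| = `|lam| / 2 by rewrite normrM (@ger0_norm _ 2^-1).
have IHl : G (lam / 2) <= expR (2 * c * (lam / 2) ^+ 2).
  apply: IH; rewrite nl2; last first.
    by apply: le_trans hl; rewrite ler_pdivrMr // ler_peMr // ler1n.
  by rewrite mulrAC ler_pdivrMr // mulrAC -mulrA mulrC; move: hn; rewrite exprS; lra.
set q := lam ^+ 2 * c / 2 in rec.
have q0 : 0 <= q by rewrite divr_ge0 // mulr_ge0 ?sqr_ge0.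
have q1 : q <= 16^-1.
  have := le_trans (ler_wpM2r c0 l2) hc; rewrite /q; lra.
have Gh0 : 0 <= G (lam / 2) by apply: mean_ge0 => // w; exact: expR_ge0.
have G2 : G (lam / 2) ^+ 2 <= expR (c * lam ^+ 2).
  have -> : c * lam ^+ 2 = 2%:R * (2 * c * (lam / 2) ^+ 2) by field.
  by rewrite expRM_natl lerXn2r ?nnegrE ?expR_ge0.
have : G lam <= (1 - q)^-1 * G (lam / 2) ^+ 2.
  by rewrite mulrC ler_pdivlMr; lra.
move=> /le_trans -> //.
have -> : 2 * c * lam ^+ 2 = 2 * q + c * lam ^+ 2 by rewrite /q; field.
rewrite expRD ler_pM ?sqr_ge0 ?invr_ge0 //; first by lra.
by apply: inv_le_expR; lra.
Qed.

Lemma two_sided_tail (lam0 r : R) : 0 <= lam0 -> lam0 * b <= 2^-1 ->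
  lam0 ^+ 2 * c <= 8^-1 -> 0 <= b ->
  mean mu (fun w => (r <= `|F w - mean mu F|)%R%:R) <=
  8 / 3 * expR (- (lam0 * r)).
Proof.
move=> l0 hb hc b0.
have half lam : `|lam| = lam0 ->
    mean mu (fun w => expR (lam * (F w - mean mu F))) <= 4 / 3.
  move=> lE; apply: (le_trans (mgf_bound hb hc _ b0)); first by rewrite lE.
  rewrite -(real_normK (num_real lam)) lE.
  apply: (le_trans (expR_le_inv _)); first by nra.
  by rewrite -[_^-1]mul1r ler_pdivrMr; nra.
apply: (@le_trans _ _ (mean mu (fun w => expR (- (lam0 * r)) *
    (expR (lam0 * (F w - mean mu F)) + expR (- lam0 * (F w - mean mu F)))))).
  apply: mean_le => // w; case: (boolP (r <= _)) => hr /=; last first.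
    by rewrite mulr_ge0 ?addr_ge0 ?expR_ge0.
  rewrite mulrDr -!expRD -expR0.
  have [s0|s0] := leP 0 (F w - mean mu F).
    rewrite ger0_norm // in hr; rewrite -[leLHS]addr0 lerD ?expR_ge0 // ler_expR.
    by rewrite addrC subr_ge0 ler_wpM2l.
  rewrite ltr0_norm // in hr; rewrite -[leLHS]add0r lerD ?expR_ge0 // ler_expR.
  by rewrite addrC mulNr -mulrN subr_ge0 ler_wpM2l.
rewrite meanZ meanD mulrC ler_wpM2r ?expR_ge0 //.
have := half lam0 (ger0_norm l0).
have := half (- lam0) _; rewrite normrN ger0_norm // => /(_ erefl); lra.
Qed.

End ProductConcentration.

(** * Infima of linear functionals *)

Section LinearInfimum.
Context {R : realType} {I : finType}.
Variable G : set (I -> R).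
Implicit Types (alpha beta g : I -> R).

(** The minimal energy has this form: [alpha] holds the conductances, and [G] the
    squared gradients of the admissible functions. *)
Definition linear_inf alpha : R := inf [set \sum_i alpha i * g i | g in G].

Variables (h s kappa : R).
Hypothesis kappa_ge1 : 1 <= kappa.
Hypothesis h_ge0 : 0 <= h.
Hypothesis G_ge0 : forall g i, G g -> 0 <= g i.
Hypothesis G_trunc : forall g, G g ->
  exists2 g', G g' & forall i, g' i <= g i /\ g' i <= h.
Hypothesis G_lin : exists2 g, G g & \sum_i g i <= s.

Definition elliptic alpha := forall i, kappa^-1 <= alpha i <= kappa.

Let kappa_gt0 : 0 < kappa. Proof. exact: lt_le_trans ltr01 kappa_ge1. Qed.

Lemma elliptic_ge0 alpha i : elliptic alpha -> 0 <= alpha i.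
Proof. by move=> /(_ i) /andP[+ _]; apply: le_trans; rewrite invr_ge0 ltW. Qed.

Lemma linear_inf_le alpha g : elliptic alpha -> G g ->
  linear_inf alpha <= \sum_i alpha i * g i.
Proof.
move=> ea Gg; apply: ge_inf; last by exists g.
exists 0 => _ [g' Gg' <-]; apply: sumr_ge0 => i _.
by apply: mulr_ge0; [exact: elliptic_ge0 | exact: G_ge0].
Qed.

Lemma linear_inf_near_min alpha (e : R) : elliptic alpha -> 0 < e ->
  exists g, [/\ G g, forall i, 0 <= g i <= h &
                \sum_i alpha i * g i <= linear_inf alpha + e].
Proof.
move=> ea e0.
have [_ [g Gg <-] lt] : exists2 x, [set \sum_i alpha i * g i | g in G] x &
    x < linear_inf alpha + e.
  apply: inf_adherent => //; split.
    by have [g Gg _] := G_lin; exists (\sum_i alpha i * g i); exists g.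
  exists 0 => _ [g' Gg' <-]; apply: sumr_ge0 => i _.
  by apply: mulr_ge0; [exact: elliptic_ge0 | exact: G_ge0].
have [g' Gg' Hg'] := G_trunc Gg; exists g'; split => //.
  by move=> i; rewrite G_ge0 //; case: (Hg' i).
apply: le_trans (ltW lt); apply: ler_sum => i _.
by rewrite ler_wpM2l ?elliptic_ge0 //; case: (Hg' i).
Qed.

Lemma linear_inf_ub alpha : elliptic alpha -> linear_inf alpha <= kappa * s.
Proof.
move=> ea; have [g Gg gs] := G_lin.
apply: (le_trans (linear_inf_le ea Gg)).
apply: le_trans (ler_wpM2l (ltW kappa_gt0) gs); rewrite big_distrr.
apply: ler_sum => i _; rewrite ler_wpM2r ?G_ge0 //.
by case/andP: (ea i).
Qed.

Lemma linear_inf_ge0 alpha : elliptic alpha -> 0 <= linear_inf alpha.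
Proof.
move=> ea; apply: lb_le_inf.
  by have [g Gg _] := G_lin; exists (\sum_i alpha i * g i); exists g.
move=> _ [g Gg <-]; apply: sumr_ge0 => i _.
by apply: mulr_ge0; [exact: elliptic_ge0 | exact: G_ge0].
Qed.

(** Concavity: a near-minimiser for [alpha] is a trial element for [beta]. *)
Lemma linear_inf_diff alpha beta g (e : R) :
  elliptic beta -> G g -> \sum_i alpha i * g i <= linear_inf alpha + e ->
  linear_inf beta - linear_inf alpha <= \sum_i (beta i - alpha i) * g i + e.
Proof.
move=> eb Gg ga; have := linear_inf_le eb Gg.
under [X in _ -> _ <= X + _]eq_bigr do rewrite mulrBl.
by rewrite sumrB; lra.
Qed.

Lemma linear_inf_lip alpha beta (delta : R) :
  elliptic alpha -> elliptic beta -> (forall i, `|beta i - alpha i| <= delta) ->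
  `|linear_inf beta - linear_inf alpha| <= #|I|%:R * (delta * h).
Proof.
move=> + + H; have {}H : forall i, `|beta i - alpha i| <= delta /\
    `|alpha i - beta i| <= delta by move=> i; rewrite (distrC (alpha i)); split.
suff one a b : elliptic a -> elliptic b -> (forall i, `|b i - a i| <= delta) ->
    linear_inf b - linear_inf a <= #|I|%:R * (delta * h).
  move=> ea eb; rewrite ler_norml.
  have := one _ _ ea eb (fun i => proj1 (H i)).
  by have := one _ _ eb ea (fun i => proj2 (H i)); move=> *; apply/andP; split; lra.
move=> ea eb {}H; apply/ler_addgt0Pr => e e0.
have [g [Gg g01 ga]] := linear_inf_near_min ea e0.
apply: (le_trans (linear_inf_diff eb Gg ga)); rewrite lerD2r.
apply: (@le_trans _ _ (\sum_(i : I) delta * h)); last first.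
  by rewrite sumr_const mulr_natl.
apply: ler_sum => i _; have /andP[g0 g1] := g01 i.
apply: (@le_trans _ _ (delta * g i)).
  by rewrite ler_wpM2r // (le_trans (ler_norm _)).
by rewrite ler_wpM2l // (le_trans _ (H i)).
Qed.

Lemma sum_coord (i : I) (x : I -> R) : (forall j, j != i -> x j = 0) ->
  \sum_j x j = x i.
Proof. by move=> H; rewrite (bigD1 i) //= big1 ?addr0. Qed.

Lemma linear_inf_osc alpha beta i : elliptic alpha -> elliptic beta ->
  (forall j, j != i -> beta j = alpha j) ->
  linear_inf beta - linear_inf alpha <= kappa * h.
Proof.
move=> ea eb bE; apply/ler_addgt0Pr => e e0.
have [g [Gg g01 ga]] := linear_inf_near_min ea e0.
apply: (le_trans (linear_inf_diff eb Gg ga)); rewrite lerD2r.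
rewrite (sum_coord (i := i)); last by move=> j ji; rewrite bE // subrr mul0r.
have /andP[g0 g1] := g01 i.
apply: (@le_trans _ _ (kappa * g i)); last by rewrite ler_wpM2l // ltW.
rewrite ler_wpM2r //; have /andP[_] := eb i; have := elliptic_ge0 i ea; lra.
Qed.

(** One near-minimiser [g] for [alpha] controls the change of every single
    coordinate.  Ellipticity turns its energy into a bound on the sum of [g], and
    the sum of the squares of [g] is at most [h] times that.  The strict
    inequality leaves room for the error of the near-minimiser. *)
Lemma linear_inf_coord alpha (c : R) : elliptic alpha -> kappa ^+ 4 * h * s < c ->
  exists D : I -> R,
   (forall i beta, elliptic beta -> (forall j, j != i -> beta j = alpha j) ->
      linear_inf beta - linear_inf alpha <= D i) /\
   \sum_i D i ^+ 2 <= c.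
Proof.
move=> ea hc.
have s0 : 0 <= s.
  by have [g Gg] := G_lin; apply: le_trans; apply: sumr_ge0 => i _; exact: G_ge0.
set B : R := kappa ^+ 3 * h + 2 * kappa ^+ 2 * (kappa * s + 1) + #|I|%:R + 1.
have B0 : 0 < B.
  rewrite ltr_pwDr // addr_ge0 // addr_ge0 // !mulr_ge0 ?exprn_ge0 ?addr_ge0
    ?mulr_ge0 //; exact: ltW.
have [e [e0 e1 eB]] : exists e, [/\ 0 < e, e <= 1 & e * B <= c - kappa ^+ 4 * h * s].
  exists (Num.min 1 ((c - kappa ^+ 4 * h * s) / B)); split.
  - by rewrite lt_min ltr01 divr_gt0 // subr_gt0.
  - by rewrite ge_min lexx.
  - by rewrite -ler_pdivlMr // ge_min lexx orbT.
have [g [Gg g01 ga]] := linear_inf_near_min ea e0.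
have g0 i : 0 <= g i by case/andP: (g01 i).
exists (fun i => kappa * g i + e); split.
  move=> i beta eb bE; apply: (le_trans (linear_inf_diff eb Gg ga)); rewrite lerD2r.
  rewrite (sum_coord (i := i)); last by move=> j ji; rewrite bE // subrr mul0r.
  rewrite ler_wpM2r //; have /andP[_] := eb i; have := elliptic_ge0 i ea; lra.
have sg : \sum_i g i <= kappa * (kappa * s + e).
  have : kappa^-1 * \sum_i g i <= kappa * s + e.
    rewrite big_distrr; apply: le_trans (lerD (linear_inf_ub ea) (lexx e)).
    apply: le_trans ga; apply: ler_sum => i _; rewrite ler_wpM2r //.
    by case/andP: (ea i).
  by rewrite ler_pdivrMl.
have sg0 : 0 <= \sum_i g i by apply: sumr_ge0.
apply: (@le_trans _ _ ((kappa ^+ 2 * h + 2 * kappa * e) * \sum_i g i + #|I|%:R * e)).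
  rewrite big_distrr -sumr_const mulr_suml -big_split; apply: ler_sum => i _ /=.
  have /andP[_ g1] := g01 i.
  have -> : (kappa * g i + e) ^+ 2 = kappa ^+ 2 * (g i * g i) + 2 * kappa * e * g i + e * e by ring.
  rewrite lerD //; last by rewrite ler_wpM2r // ltW.
  rewrite [leRHS](mulrDl (_ * h)) lerD // -mulrA ler_wpM2l ?sqr_ge0 // ler_wpM2r //.
have k2 : 0 <= kappa ^+ 2 * h + 2 * kappa * e.
  by rewrite addr_ge0 // !mulr_ge0 ?exprn_ge0 // ltW.
apply: (le_trans (lerD (ler_wpM2l k2 sg) (lexx _))).
rewrite /B in eB.
have ee : e * e <= e * 1 by rewrite ler_wpM2l // ltW.
have : kappa ^+ 2 * (e * e) <= kappa ^+ 2 * e.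
  by rewrite ler_wpM2l ?sqr_ge0 // -[leRHS]mulr1.
lra.
Qed.

End LinearInfimum.

(** * The edges of the box *)

Section LatticeBox.
Context {R : realType} (d N : nat).
Implicit Types x y : Qbar d N.

Definition box_edge : Type := {p : Qbar d N * Qbar d N | oriented_edge p}.
HB.instance Definition _ := Finite.on box_edge.

Definition edge_fset (i : box_edge) : {fset lattice d} :=
  [fset to_lattice (val i).1; to_lattice (val i).2]%fset.

Definition sqgrad (u : Qbar d N -> R) (i : box_edge) : R :=
  (u (val i).1 - u (val i).2) ^+ 2.

Lemma eff_conductanceE (a : {fset lattice d} -> R) :
  eff_conductance N a =
  N%:R ^- d.+1 * linear_inf [set sqgrad u | u in @admissible R d N]
                   (fun i => a (edge_fset i)).
Proof.
congr (_ * inf _); rewrite image_comp; apply: eq_imagel => u _ /=.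
rewrite /energy big_sub /=; apply: eq_bigr => i _.
by rewrite /conductance /sqgrad expr2 mulrA.
Qed.

Lemma to_lattice_inj : injective (@to_lattice d N).
Proof.
move=> x y xy; apply/ffunP => i; apply: val_inj => /=.
by have /ffunP/(_ i) := xy; rewrite !ffunE => -[].
Qed.

(** The orientation makes the pair of endpoints recoverable from the set: both
    orders would be coordinatewise increasing only if the endpoints coincided. *)
Lemma edge_fset_inj : injective edge_fset.
Proof.
move=> [[x1 y1] /= o1] [[x2 y2] /= o2]; rewrite /edge_fset /= => E.
apply: val_inj => /=.
have /and3P[/= _ /forallP le1 _] := o1; have /and3P[/= _ /forallP le2 _] := o2.
have mem z : (z == x1) || (z == y1) = ((z == x2) || (z == y2)).
  by have /fsetP/(_ (to_lattice z)) := E; rewrite !inE !(inj_eq to_lattice_inj).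
have anti x y : (forall i, x i <= y i)%N -> (forall i, y i <= x i)%N -> x = y.
  by move=> h1 h2; apply/ffunP => i; apply/val_inj/anti_leq; rewrite h1 h2.
have := mem x1; have := mem y1; have := mem x2; have := mem y2; rewrite !eqxx ?orbT /=.
move=> /orP[]/eqP e1 /orP[]/eqP e2 /esym/orP[]/eqP e3 /esym/orP[]/eqP e4; subst => //.
by have := anti _ _ le1 le2 => ->.
Qed.

Lemma edge_fset_edges i : edges (edge_fset i).
Proof.
by case/and3P: (valP i) => adj _ _; exists (to_lattice (val i).1), (to_lattice (val i).2).
Qed.

Lemma adj_sqr_le1 (x y : lattice d) i : adj x y -> (x i - y i) ^+ 2 <= 1.
Proof.
move=> /eqP <-; rewrite (bigD1 i) //= lerDl; apply: sumr_ge0 => j _; exact: sqr_ge0.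
Qed.

Lemma adj_coord (x y : lattice d) i j : adj x y -> i != j -> x i != y i -> x j = y j.
Proof.
move=> a ij xyi; apply/eqP/negPn/negP => xyj.
have pos k : x k != y k -> 1 <= (x k - y k) ^+ 2.
  by move=> ne; rewrite -gtz0_ge1 exprn_even_gt0 // subr_eq0.
move: a; rewrite /adj (bigD1 i) //= (bigD1 j) /=; last by rewrite eq_sym.
set S := \sum_(_ < _ | _) _; have S0 : 0 <= S by apply: sumr_ge0 => k _; exact: sqr_ge0.
by have := pos _ xyi; have := pos _ xyj; move=> + + /eqP; lia.
Qed.

Lemma admissible_comp (phi : R -> R) u : phi 0 = 0 -> phi N.+1%:R = N.+1%:R ->
  @admissible R d N u -> @admissible R d N (phi \o u).
Proof.
move=> p0 p1 [u0 u1 u2]; split => [x bx x0|x bx x0|x y xy bx x0 x1 qy] /=.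
- by rewrite u0.
- by rewrite u1.
- by rewrite (u2 x y).
Qed.

Definition linear_fun x : R := (x ord0 : nat)%:R.

(** A lateral boundary point differs from its neighbour in the box in a
    coordinate other than the first, hence not in the first. *)
Lemma linear_fun_admissible : @admissible R d N linear_fun.
Proof.
rewrite /linear_fun; split => [x _ -> //|x _ -> //|x y xy bx x0 x1 qy].
have [i xi] : exists i, ~~ (0 < x i < N.+1)%N.
  by apply/existsP; rewrite -negb_forall.
have yi : (0 < y i < N.+1)%N by move/forallP: qy; apply.
have i0 : i != ord0.
  by apply: contraNneq xi => ->; have := ltn_ord (x ord0); lia.
have := adj_coord xy i0; rewrite !ffunE => H.
have /H[-> //] : (x i : nat)%:Z != (y i : nat)%:Z.
by apply: contraNneq xi => -[->].
Qed.

(** Only the edges in the first direction contribute, one each, and such an edge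
    is determined by its lower endpoint: the first coordinate is in [0, N], the
    others are in [1, N] because one endpoint lies in the box. *)
Lemma sum_sqgrad_linear : \sum_i sqgrad linear_fun i <= N.+1%:R * N%:R ^+ d.
Proof.
pose A := [set i : box_edge | (val i).1 ord0 != (val i).2 ord0]%SET.
have adjE (i : box_edge) : box_adj (val i).1 (val i).2 by case/and3P: (valP i).
have leE (i : box_edge) j : ((val i).1 j <= (val i).2 j)%N.
  by case/and3P: (valP i) => _ /forallP/(_ j).
have sndE i : i \in A -> ((val i).2 ord0 = ((val i).1 ord0).+1 :> nat) /\
    forall j, j != ord0 -> (val i).2 j = (val i).1 j.
  rewrite inE => ne; have neZ : to_lattice (val i).1 ord0 != to_lattice (val i).2 ord0.
    by rewrite !ffunE; apply: contraNneq ne => -[e]; apply/eqP/val_inj.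
  split=> [|j j0].
    have := adj_sqr_le1 ord0 (adjE i); have := leE i ord0; move: neZ; rewrite !ffunE.
    rewrite expr2; move: (nat_of_ord _) (nat_of_ord _) => p q npq pq sq; nia.
  have := adj_coord (adjE i) (j := j) _ neZ; rewrite eq_sym => /(_ j0).
  by rewrite !ffunE => -[/val_inj].
have -> : \sum_i sqgrad linear_fun i = #|A|%:R.
  rewrite -sumr_const [RHS]big_mkcond; apply: eq_bigr => i _.
  rewrite /sqgrad /linear_fun; case: ifPn => [/sndE[-> _]|].
    by rewrite -natr1 opprD addrA subrr sub0r sqrrN expr1n.
  by rewrite inE negbK => /eqP ->; rewrite subrr expr0n.
have -> : N.+1%:R * N%:R ^+ d = (N.+1 * N ^ d)%:R :> R by rewrite natrM natrX.
rewrite ler_nat.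
pose B (j : 'I_d.+1) : pred 'I_N.+2 :=
  fun k => if j == ord0 then (k < N.+1)%N else (0 < k < N.+1)%N.
have inj : {in A &, injective (fun i : box_edge => (val i).1)}.
  move=> i1 i2 /sndE[a1 b1] /sndE[a2 b2] /= e; apply: val_inj.
  rewrite [val i1]surjective_pairing [val i2]surjective_pairing e; congr pair.
  apply/ffunP => j; case: (eqVneq j ord0) => [->|j0]; last by rewrite b1 // b2 // e.
  by apply: val_inj; rewrite /= a1 a2 e.
rewrite -[X in (X <= _)%N](card_in_image inj).
apply: (@leq_trans #|family (B : forall j, pred _)|).
  apply: subset_leq_card; apply/fintype.subsetP => x. case/fintype.imageP => i iA ->.
  have [a1 b1] := sndE _ iA.
  apply/familyP => j; rewrite unfold_in /B /=; case: (eqVneq j ord0) => [->|j0].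
    by have := ltn_ord ((val i).2 ord0); rewrite a1.
  case/and3P: (valP i) => _ _ /orP[]/forallP/(_ j) //.
  by rewrite b1.
have wid_inj m : injective (widen_ord (leqnSn m)).
  by move=> k l /(congr1 val) /= kl; apply: val_inj.
rewrite card_family foldrE big_map big_enum /= big_ord_recl; apply: leq_mul.
  rewrite -[leqRHS](card_ord N.+1) -[leqRHS](fintype.card_image (wid_inj _)).
  apply: subset_leq_card; apply/fintype.subsetP => k kN0.
  have kN : (k < N.+1)%N := kN0.
  by apply/fintype.imageP; exists (Ordinal kN) => //; apply: val_inj.
have inj2 : injective (fun k : 'I_N => lift ord0 (widen_ord (leqnSn N) k)).
  by move=> k l /lift_inj/wid_inj.
rewrite -[in leqRHS](card_ord d) -prod_nat_const; apply: leq_prod => j _.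
rewrite -[leqRHS](card_ord N) -[leqRHS](fintype.card_image inj2).
apply: subset_leq_card; apply/fintype.subsetP => k kN0.
have {kN0} : (0 < k < N.+1)%N := kN0.
case: k => -[//|k] kN2 /= kN; apply/fintype.imageP; exists (Ordinal (kN : k < N)%N) => //.
by apply: val_inj; rewrite /= /bump leq0n.
Qed.

End LatticeBox.

(** * Deterministic bounds on the effective conductance *)

Section EffectiveConductanceBounds.
Context {R : realType} (d N : nat).
Hypothesis N_gt0 : (0 < N)%N.
Variable kappa : R.
Hypothesis kappa_ge1 : 1 <= kappa.

Let G : set (box_edge d N -> R) := [set sqgrad u | u in @admissible R d N].

Definition box_conductance (alpha : box_edge d N -> R) : R :=
  N%:R ^- d.+1 * linear_inf G alpha.

(** Truncation fixes the boundary values 0 and N+1 and is a contraction, so it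
    keeps a function admissible without raising its energy. *)
Definition clamp (r : R) := Num.max 0 (Num.min r N.+1%:R).

Lemma clamp_itv r : 0 <= clamp r <= N.+1%:R.
Proof. by rewrite /clamp le_max lexx ge_max ler0n ge_min lexx orbT. Qed.

Lemma clamp_sqr_le r1 r2 : (clamp r1 - clamp r2) ^+ 2 <= (r1 - r2) ^+ 2.
Proof.
have N0 := ler0n R N.+1.
rewrite -[leLHS]real_normK ?num_real // -[leRHS]real_normK ?num_real //.
rewrite lerXn2r ?nnegrE // /clamp /Num.max /Num.min.
case: (ltP r1 _) => h1; case: (ltP r2 _) => h2;
  rewrite ?ltr0Sn; try (case: (ltP 0 r1) => h3); try (case: (ltP 0 r2) => h4);
  rewrite ?subrr ?normr0 // ler_norml; apply/andP;
  have := ler_norm (r1 - r2); have := ler_norm (r2 - r1); rewrite (distrC r2); split; lra.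
Qed.

Let G_ge0 g i : G g -> 0 <= g i.
Proof. by move=> [u _ <-]; exact: sqr_ge0. Qed.

Let h : R := N.+1%:R ^+ 2.

Let h_ge0 : 0 <= h. Proof. exact: sqr_ge0. Qed.

Let G_trunc g : G g -> exists2 g', G g' & forall i, g' i <= g i /\ g' i <= h.
Proof.
move=> [u uadm <-]; exists (sqgrad (clamp \o u)).
  exists (clamp \o u) => //; apply: admissible_comp => //.
  - by rewrite /clamp min_l ?maxxx.
  - by rewrite /clamp minxx max_r.
move=> i; split; first exact: clamp_sqr_le.
rewrite /sqgrad /= /h -[leLHS]real_normK ?num_real // lerXn2r ?nnegrE // ler_norml.
have /andP[a0 a1] := clamp_itv (u (val i).1).
by have /andP[b0 b1] := clamp_itv (u (val i).2); apply/andP; split; lra.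
Qed.

Let s : R := N.+1%:R * N%:R ^+ d.

Let G_lin : exists2 g, G g & \sum_i g i <= s.
Proof.
exists (sqgrad (@linear_fun R d N)); last exact: sum_sqgrad_linear.
by exists (@linear_fun R d N) => //; exact: linear_fun_admissible.
Qed.

(** The order of the variance, N^(2-D) in dimension D = d+1. *)
Definition var_scale : R := N%:R ^+ 2 / N%:R ^+ d.+1.

Let Np : 0 < N%:R :> R. Proof. by rewrite ltr0n. Qed.
Let ND : 0 < N%:R ^+ d.+1 :> R. Proof. exact: exprn_gt0. Qed.
Let N2 : N.+1%:R <= 2 * N%:R :> R.
Proof. by rewrite -natr1 mulr2n mulrDl mul1r lerD2l ler1n. Qed.
Let kappa0 : 0 < kappa. Proof. exact: lt_le_trans ltr01 kappa_ge1. Qed.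

Lemma box_conductance_ge0 alpha : elliptic kappa alpha -> 0 <= box_conductance alpha.
Proof.
move=> ea; rewrite mulr_ge0 ?invr_ge0 ?(ltW ND) //.
exact: (linear_inf_ge0 kappa_ge1 G_ge0 G_lin).
Qed.

Lemma box_conductance_lip alpha beta (delta : R) :
  elliptic kappa alpha -> elliptic kappa beta -> (forall i, `|beta i - alpha i| <= delta) ->
  `|box_conductance beta - box_conductance alpha| <=
    N%:R ^- d.+1 * (#|{: box_edge d N}|%:R * h) * delta.
Proof.
move=> ea eb H; rewrite -mulrBr normrM ger0_norm ?invr_ge0 ?(ltW ND) // -mulrA.
rewrite ler_wpM2l ?invr_ge0 ?(ltW ND) // -mulrA (mulrC h).
exact: (linear_inf_lip kappa_ge1 G_ge0 G_trunc G_lin).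
Qed.

Lemma box_conductance_osc alpha beta i : elliptic kappa alpha -> elliptic kappa beta ->
  (forall j, j != i -> beta j = alpha j) ->
  box_conductance beta - box_conductance alpha <= 4 * kappa * var_scale.
Proof.
move=> ea eb bE; rewrite -mulrBr mulrC ler_pdivrMr // /var_scale mulrA mulfVK ?gt_eqF //.
apply: (le_trans (linear_inf_osc kappa_ge1 G_ge0 G_trunc G_lin ea eb bE)).
rewrite (mulrC 4) -mulrA ler_wpM2l ?(ltW kappa0) //.
have -> : 4 * N%:R ^+ 2 = (2 * N%:R) ^+ 2 :> R by ring.
by rewrite lerXn2r // nnegrE // mulr_ge0 // ltW.
Qed.

(** The sum is at most 8 kappa^4 N^(2-D) up to the error of a near-minimiser,
    by N+1 <= 2N. *)
Lemma box_conductance_coord alpha : elliptic kappa alpha -> exists D : box_edge d N -> R,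
   (forall i beta, elliptic kappa beta -> (forall j, j != i -> beta j = alpha j) ->
      box_conductance beta - box_conductance alpha <= D i) /\
   \sum_i D i ^+ 2 <= 9 * kappa ^+ 4 * var_scale.
Proof.
move=> ea; have k4 : 0 < kappa ^+ 4 by exact: exprn_gt0.
have X0 : 0 < N%:R ^+ 2 * N%:R ^+ d.+1 :> R by rewrite mulr_gt0 ?exprn_gt0.
have hc : kappa ^+ 4 * h * s < 9 * kappa ^+ 4 * (N%:R ^+ 2 * N%:R ^+ d.+1).
  apply: (@le_lt_trans _ _ (8 * kappa ^+ 4 * (N%:R ^+ 2 * N%:R ^+ d.+1))); last first.
    by rewrite ltr_pM2r // ltr_pM2r // ltr_nat.
  have -> : kappa ^+ 4 * h * s = kappa ^+ 4 * (N.+1%:R ^+ 3 * N%:R ^+ d).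
    by rewrite /h /s; ring.
  have -> : 8 * kappa ^+ 4 * (N%:R ^+ 2 * N%:R ^+ d.+1) =
      kappa ^+ 4 * ((2 * N%:R) ^+ 3 * N%:R ^+ d).
    by rewrite [N%:R ^+ d.+1]exprS; ring.
  apply: ler_wpM2l; first exact: ltW.
  rewrite ler_wpM2r ?exprn_ge0 ?(ltW Np) // lerXn2r // nnegrE // mulr_ge0 // ltW //.
have [D [D1 D2]] := linear_inf_coord kappa_ge1 h_ge0 G_ge0 G_trunc G_lin ea hc.
exists (fun i => N%:R ^- d.+1 * D i); split.
  move=> i beta eb bE; rewrite -mulrBr ler_wpM2l ?invr_ge0 ?(ltW ND) //.
  exact: D1.
under eq_bigr do rewrite exprMn.
rewrite -big_distrr /=; apply: (le_trans (ler_wpM2l (sqr_ge0 _) D2)).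
rewrite le_eqVlt; apply/orP; left; apply/eqP; rewrite /var_scale.
by field; rewrite gt_eqF.
Qed.

End EffectiveConductanceBounds.

(** * Measurability of the effective conductance *)

Section MeasurableInfimum.
Context {disp : measure_display} {T : measurableType disp} {R : realType}.

(** The real infimum of a set that is not bounded below is 0, so this case is
    separated; unboundedness below is itself decided by the countable family. *)
Lemma measurable_inf_countable (U : countType) (A : set U) (v : U -> T -> R)
    (S : T -> set R) :
  (forall w, S w !=set0) -> (forall q, A q -> measurable_fun setT (v q)) ->
  (forall q w, A q -> S w (v q w)) ->
  (forall w x t, S w x -> x < t -> exists2 q, A q & v q w < t) ->
  measurable_fun setT (fun w => inf (S w)).
Proof.
move=> S0 mv vS Sv.
pose W (t : R) := [set w | exists2 x, S w x & x < t].
have mW t : measurable (W t).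
  have -> : W t = \bigcup_q [set w | A q /\ v q w < t].
    apply/seteqP; split => w /=; last first.
      by move=> [q _ [Aq vt]]; exists (v q w) => //; exact: vS.
    by move=> [x Sx xt]; have [q Aq vt] := Sv _ _ _ Sx xt; exists q.
  apply: countable_bigcupT_measurable => // q.
  have [Aq|nA] := pselect (A q); last first.
    by rewrite (_ : mkset _ = set0) //; apply/seteqP; split => // w [].
  rewrite (_ : mkset _ = setT `&` v q @^-1` [set` `]-oo, t[]).
    by apply: mv => //; exact: measurable_itv.
  by apply/seteqP; split => w /=; rewrite in_itv /=; [case|case].
pose Unb := \bigcap_(n : nat) W (- n%:R).
have mUnb : measurable Unb by exact: bigcapT_measurable.
have UnbP w : Unb w <-> ~ has_inf (S w).
  split=> [uw [_ [b lb]]|ninf n _].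
    have [x Sx xlt] := uw (Num.bound b) I.
    have := lb _ Sx; have := archi_boundP (normr_ge0 b); have := ler_norm (- b).
    rewrite normrN; have : (Num.bound b)%:R = (Num.bound `|b|)%:R :> R.
      by rewrite /Num.bound normr_id.
    move=> *; lra.
  apply: contrapT => nW; apply: ninf; split; first exact: S0.
  exists (- n%:R) => x Sx; rewrite leNgt; apply/negP => xlt.
  by apply: nW; exists x.
move=> mT; apply: (measurability _ (RGenInftyO.measurableE R)) => //.
move=> _ [_ [t ->] <-]; rewrite setTI.
rewrite (_ : _ @^-1` _ = (Unb `&` [set w | 0 < t]) `|` (~` Unb `&` W t)).
  apply: measurableU; apply: measurableI => //; last exact: measurableC.
  have [t0|t0] := ltP 0 t.
    by rewrite (_ : mkset _ = setT) //; apply/seteqP; split.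
  by rewrite (_ : mkset _ = set0) //; apply/seteqP; split.
apply/seteqP; split => w /=; rewrite in_itv /=.
- move=> it; have [u|nu] := pselect (Unb w).
    left; split=> //; have /UnbP/inf_out e := u; by rewrite e in it.
  by right; split=> //; have [x Sx xlt] := inf_lt (S0 w) it; exists x.
- move=> [[/UnbP/inf_out -> //]|[nu [x Sx xt]]].
  have hi : has_inf (S w) by apply: contrapT => /UnbP.
  by apply: le_lt_trans xt; apply: ge_inf => //; case: hi.
Qed.

End MeasurableInfimum.

Section MeasurableConductance.
Context {disp : measure_display} {T : measurableType disp} {R : realType}.
Context (d N : nat).

Definition rational_fun (q : {ffun Qbar d N -> rat}) (x : Qbar d N) : R := ratr (q x).

(** Composing a function with this rounding preserves the equalities between
    values that admissibility demands, since equal values are rounded alike, and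
    the boundary values, since integers are fixed. *)
Definition grid (n : nat) (r : R) : R := (Num.floor (r * n%:R))%:~R / n%:R.

Lemma grid_nat n (m : nat) : (0 < n)%N -> grid n m%:R = m%:R.
Proof.
move=> n0; rewrite /grid -natrM [in Num.floor _]pmulrn intrKfloor -pmulrn.
by rewrite natrM mulfK // pnatr_eq0 -lt0n.
Qed.

Lemma grid_near n r : (0 < n)%N -> `|grid n r - r| <= n%:R^-1.
Proof.
move=> n0; have n0' : 0 < n%:R :> R by rewrite ltr0n.
have -> : grid n r - r = ((Num.floor (r * n%:R))%:~R - r * n%:R) / n%:R.
  by rewrite /grid mulrBl mulfK ?gt_eqF.
have ni : 0 <= n%:R^-1 :> R by rewrite invr_ge0 ltW.
rewrite normrM (ger0_norm ni) -[leRHS]mul1r ler_wpM2r // ler_norml.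
have /andP[] := floor_itv (r * n%:R); rewrite intrD => *; apply/andP; split; lra.
Qed.

Lemma energy_grid_lt (alpha : box_edge d N -> R) (u : Qbar d N -> R) (t : R) :
  \sum_i alpha i * sqgrad u i < t ->
  exists2 n, (0 < n)%N & \sum_i alpha i * sqgrad (grid n \o u) i < t.
Proof.
set e0 := \sum_i _ => et.
pose C := \sum_i `|alpha i| * (4 * `|u (val i).1 - u (val i).2| + 4).
have C0 : 0 <= C.
  by apply: sumr_ge0 => i _; rewrite mulr_ge0 // addr_ge0 // mulr_ge0.
have te : 0 < t - e0 by rewrite subr_gt0.
pose n := (Num.bound (C / (t - e0))).+1.
have nC : C / (t - e0) < n%:R.
  apply: lt_le_trans (archi_boundP _) _; first by rewrite divr_ge0 // ltW.
  by rewrite ler_nat.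
have n0 : 0 < n%:R :> R by rewrite ltr0n.
exists n => //; apply: (@le_lt_trans _ _ (e0 + C / n%:R)); last first.
  by rewrite -ltrBrDl ltr_pdivrMr // mulrC -ltr_pdivrMr.
rewrite /C mulr_suml -big_split; apply: ler_sum => i _ /=.
rewrite /sqgrad /=; set a := u _; set b := u _.
have ha := grid_near a (ltn0Sn _ : 0 < n)%N; have hb := grid_near b (ltn0Sn _ : 0 < n)%N.
set h := n%:R^-1 in ha hb *; have h1 : h <= 1 by rewrite invf_le1 // ler1n.
have h0 : 0 <= h by rewrite invr_ge0 ltW.
set x := a - b; set y := grid n a - grid n b.
have xy : `|y - x| <= 2 * h.
  rewrite (_ : y - x = (grid n a - a) - (grid n b - b)); last by rewrite /x /y; ring.
  by apply: (le_trans (ler_normB _ _)); lra.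
have : y ^+ 2 - x ^+ 2 = (y - x) * (y - x + 2 * x) by ring.
rewrite -lerBlDl -mulrBr => ->; apply: (le_trans (ler_norm _)).
rewrite normrM -mulrA ler_wpM2l // normrM.
have yx : `|y - x + 2 * x| <= 2 * h + 2 * `|x|.
  by apply: (le_trans (ler_normD _ _)); rewrite normrM (@ger0_norm _ 2) // lerD2r.
apply: (le_trans (ler_pM _ _ xy yx)) => //.
have -> : 2 * h * (2 * h + 2 * `|x|) = (4 * h + 4 * `|x|) * h by ring.
by rewrite ler_wpM2r // addrC lerD2l; lra.
Qed.

Lemma measurable_eff_conductance (a : {fset lattice d} -> T -> R) :
  (forall e, measurable_fun setT (a e)) ->
  measurable_fun setT (fun w => eff_conductance N (fun e => a e w)).
Proof.
move=> ma; under eq_fun do rewrite eff_conductanceE.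
apply: measurable_funM => //.
pose A := [set q | @admissible R d N (rational_fun q)].
apply: (@measurable_inf_countable _ _ _ _ A
  (fun q w => \sum_i a (edge_fset i) w * sqgrad (rational_fun q) i)
  (fun w => [set \sum_i a (edge_fset i) w * g i |
             g in [set sqgrad u | u in @admissible R d N]])).
- move=> w; apply/image_nonempty; apply/image_nonempty.
  by exists (@linear_fun R d N); exact: linear_fun_admissible.
- move=> q Aq; apply: measurable_sum => i; exact: measurable_funM.
- by move=> q w Aq; exists (sqgrad (rational_fun q)) => //; exists (rational_fun q).
- move=> w _ t [_ [u uadm <-] <-] /energy_grid_lt[n n0 lt].
  pose q : {ffun Qbar d N -> rat} := [ffun x => (Num.floor (u x * n%:R))%:~R / n%:R].
  have qE : rational_fun q = grid n \o u.
    apply/funext => x; rewrite /rational_fun ffunE /= fmorph_div /= ratr_int.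
    by rewrite ratr_nat.
  exists q; last by rewrite qE.
  rewrite /A /= qE; apply: admissible_comp => //; last exact: grid_nat.
  exact: (grid_nat 0).
Qed.

End MeasurableConductance.

(** * From a finite product space to the probability space *)

Section FiniteLaw.
Context {disp : measure_display} {T : measurableType disp} {R : realType}.
Context (P : probability T R) {I K : finType} (Y : I -> T -> K).
Hypothesis mY : forall i k, measurable (Y i @^-1` [set k]).
Hypothesis indepY : forall k : {ffun I -> K},
  P (\bigcap_i (Y i @^-1` [set k i])) = (\prod_i P (Y i @^-1` [set k i]))%E.

Definition law (i : I) (k : K) : R := fine (P (Y i @^-1` [set k])).

Definition joint (w : T) : {ffun I -> K} := [ffun i => Y i w].

Lemma law_ge0 i k : 0 <= law i k.
Proof. exact/fine_ge0/measure_ge0. Qed.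

(** A function of a random variable with finitely many values is a finite
    combination of indicators. *)
Lemma finite_expectation (J : finType) (Z : T -> J) (g : J -> R) :
  (forall j, measurable (Z @^-1` [set j])) -> (forall j, 0 <= g j) ->
  (\int[P]_w (g (Z w))%:E = (\sum_j fine (P (Z @^-1` [set j])) * g j)%:E)%E.
Proof.
move=> mZ g0.
transitivity (\int[P]_w (\sum_j (g j)%:E * (\1_(Z @^-1` [set j]) w)%:E))%E.
  apply: eq_integral => w _; rewrite (bigD1 (Z w)) //= big1 ?adde0.
    by rewrite indicE mem_set // mule1.
  move=> j /eqP jw; rewrite indicE memNset ?mule0 //= => e; exact: jw.
rewrite ge0_integral_sum //.
- rewrite -sumEFin; apply: eq_bigr => j _.
  rewrite ge0_integralZl ?lee_fin //.
    rewrite integral_indic // setIT muleC EFinM fineK //.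
    exact: fin_num_measure.
  by apply/measurable_EFinP; exact: measurable_indic.
- move=> j; apply: emeasurable_funM => //; apply/measurable_EFinP; exact: measurable_indic.
- by move=> j w _; rewrite mule_ge0 // lee_fin.
Qed.

Lemma law_sum1 i : \sum_k law i k = 1.
Proof.
have := finite_expectation (mY i) (g := fun=> 1) (fun=> ler01).
rewrite integral_cst //= probability_setT mul1e => -[->].
by apply: eq_bigr => k _; rewrite mulr1.
Qed.

Lemma jointE k : joint @^-1` [set k] = \bigcap_i (Y i @^-1` [set k i]).
Proof.
apply/seteqP; split => w /=; first by move=> <- i _ /=; rewrite ffunE.
by move=> H; apply/ffunP => i; rewrite ffunE; exact: H.
Qed.

Lemma measurable_joint k : measurable (joint @^-1` [set k]).
Proof. by rewrite jointE; apply: fin_bigcap_measurable. Qed.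

Lemma mean_law (g : {ffun I -> K} -> R) : (forall k, 0 <= g k) ->
  (\int[P]_w (g (joint w))%:E = (mean law g)%:E)%E.
Proof.
move=> g0; rewrite finite_expectation //; last exact: measurable_joint.
congr EFin; apply: eq_bigr => k _; congr (_ * _).
rewrite jointE indepY /weight.
rewrite (eq_bigr (fun i => (law i (k i))%:E)) ?prodEFin //.
by move=> i _; rewrite fineK ?fin_num_measure.
Qed.

Lemma measurable_finite (g : {ffun I -> K} -> R) :
  measurable_fun setT (fun w => g (joint w)).
Proof.
rewrite (_ : (fun _ => _) =
    (fun w => \sum_k g k * \1_(joint @^-1` [set k]) w)).
  apply: measurable_sum => k; apply: measurable_funM => //.
  exact/measurable_indic/measurable_joint.
apply/funext => w; rewrite (bigD1 (joint w)) //= big1 ?addr0.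
  by rewrite indicE mem_set // mulr1.
by move=> k /eqP kw; rewrite indicE memNset ?mulr0 //= => e; exact: kw.
Qed.

Variables (f : T -> R) (F : {ffun I -> K} -> R) (eta : R).
Hypothesis mf : measurable_fun setT f.
Hypothesis F_ge0 : forall k, 0 <= F k.
Hypothesis f_ge0 : {ae P, forall w, 0 <= f w}.
Hypothesis fF : {ae P, forall w, `|f w - F (joint w)| <= eta}.
Hypothesis eta_ge0 : 0 <= eta.

(** [f] is nonnegative only almost surely, so its positive part is compared with
    the discretised variable. *)
Lemma expectation_transfer : `|fine 'E_P[f]%E - mean law F| <= eta.
Proof.
pose f' w := Num.max 0 (f w).
have mf' : measurable_fun setT f' by exact: measurable_maxr.
have f'0 w : 0 <= f' w by rewrite le_max lexx.
have -> : 'E_P[f]%E = (\int[P]_w (f' w)%:E)%E.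
  rewrite unlock; apply: ae_eq_integral => //; try exact/measurable_EFinP.
  by apply: filterS f_ge0 => w h _; rewrite /f' max_r.
have shift (g : T -> R) : measurable_fun setT g -> (forall w, 0 <= g w) ->
    (\int[P]_w (g w + eta)%:E = \int[P]_w (g w)%:E + eta%:E)%E.
  move=> mg g0; under eq_integral do rewrite EFinD.
  rewrite ge0_integralD //=; try by move=> *; rewrite lee_fin.
    by rewrite integral_cst //= probability_setT mule1.
  exact/measurable_EFinP.
have mFj := measurable_finite F.
have le1 : (\int[P]_w (f' w)%:E <= (mean law F)%:E + eta%:E)%E.
  rewrite -mean_law // -shift //; apply: ae_ge0_le_integral => //.
  - by move=> w _; rewrite lee_fin.
  - exact/measurable_EFinP.
  - by move=> w _; rewrite lee_fin addr_ge0.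
  - by apply/measurable_EFinP; apply: measurable_funD.
  - apply: filterS fF => w; rewrite ler_norml lee_fin => /andP[h1 h2] _.
    by rewrite /f' ge_max addr_ge0 //=; lra.
have le2 : ((mean law F)%:E <= \int[P]_w (f' w)%:E + eta%:E)%E.
  rewrite -mean_law // -shift //; apply: ae_ge0_le_integral => //.
  - by move=> w _; rewrite lee_fin.
  - exact/measurable_EFinP.
  - by move=> w _; rewrite lee_fin addr_ge0.
  - by apply/measurable_EFinP; apply: measurable_funD.
  - apply: filterS fF => w; rewrite ler_norml lee_fin => /andP[h1 h2] _.
    by rewrite -lerBlDr /f' le_max; apply/orP; right; lra.
have f'int : (0 <= \int[P]_w (f' w)%:E)%E by apply: integral_ge0 => w _; rewrite lee_fin.
have fin : (\int[P]_w (f' w)%:E)%E \is a fin_num.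
  rewrite ge0_fin_numE //; apply: le_lt_trans le1 _; exact: ltry.
move: le1 le2; rewrite -(fineK fin) /= -!EFinD !lee_fin ler_norml => *.
by apply/andP; split; lra.
Qed.

Let deviation : {ae P, forall w,
  `|f w - fine 'E_P[f]%E| <= `|F (joint w) - mean law F| + 2 * eta}.
Proof.
apply: filterS fF => w h; have h' := expectation_transfer.
have -> : f w - fine 'E_P[f]%E = (F (joint w) - mean law F) +
    ((f w - F (joint w)) - (fine 'E_P[f]%E - mean law F)) by ring.
apply: (le_trans (ler_normD _ _)); rewrite lerD2l.
by apply: (le_trans (ler_normB _ _)); lra.
Qed.

Lemma tail_transfer (s : R) :
  (P [set w | (s <= `|f w - fine 'E_P[f]%E|)%R] <=
   (mean law (fun k => (s - 2 * eta <= `|F k - mean law F|)%R%:R))%:E)%E.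
Proof.
rewrite -mean_law //.
set A := mkset _.
have mA : measurable A.
  rewrite (_ : A = setT `&` (fun w => `|f w - fine 'E_P[f]%E|) @^-1` [set` `[s, +oo[]).
    apply: (measurableT_comp (f := fun x : R => `|x|)) => //.
      exact: measurable_funB.
  by apply/seteqP; split => w /=; rewrite in_itv /= andbT; [|case].
rewrite -[X in P X]setIT -integral_indic //; apply: ae_ge0_le_integral => //.
- by apply/measurable_EFinP; exact: measurable_indic.
- apply/measurable_EFinP.
  exact: (measurable_finite (fun k => (s - 2 * eta <= `|F k - mean law F|)%R%:R)).
- apply: filterS deviation => w h _; rewrite lee_fin indicE.
  have [Aw|nA] := boolP (w \in A); last by rewrite ler0n.
  have sw : s <= `|f w - fine 'E_P[f]%E| := set_mem Aw.
  have hh : s - 2 * eta <= `|F (joint w) - mean law F| by lra.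
  by rewrite hh.
Qed.

Lemma variance_transfer :
  ('V_P[f] <= (2 * mean law (fun k => (F k - mean law F) ^+ 2) + 8 * eta ^+ 2)%R%:E)%E.
Proof.
have -> : 2 * mean law (fun k => (F k - mean law F) ^+ 2) + 8 * eta ^+ 2 =
   mean law (fun k => 2 * (F k - mean law F) ^+ 2 + 8 * eta ^+ 2).
  by rewrite meanD meanZ mean_cst //; exact: law_sum1.
rewrite -mean_law; last by move=> k; rewrite addr_ge0 // mulr_ge0 ?sqr_ge0.
have -> : 'V_P[f]%E = (\int[P]_w ((f w - fine 'E_P[f]%E) ^+ 2)%:E)%E.
  by rewrite /variance covariance.unlock {1}expectation.unlock.
apply: ae_ge0_le_integral => //.
- by move=> w _; rewrite lee_fin; exact: sqr_ge0.
- by apply/measurable_EFinP; apply: measurable_funX; exact: measurable_funB.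
- by move=> w _; rewrite lee_fin addr_ge0 // mulr_ge0 ?sqr_ge0.
- apply/measurable_EFinP.
  exact: (measurable_finite (fun k => 2 * (F k - mean law F) ^+ 2 + 8 * eta ^+ 2)).
- apply: filterS deviation => w h _; rewrite lee_fin /=.
  set x := f w - _ in h *; set y := F _ - _ in h *.
  rewrite -(real_normK (num_real x)) -(real_normK (num_real y)).
  apply: (@le_trans _ _ ((`|y| + 2 * eta) ^+ 2)).
    by rewrite lerXn2r ?nnegrE // addr_ge0 // mulr_ge0.
  have := sqr_ge0 (`|y| - 2 * eta); nra.
Qed.

End FiniteLaw.

(** * Rounding the conductances *)

Section Rounding.
Context {R : realType} (kappa delta : R) (m : nat).
Hypothesis kappa_ge1 : 1 <= kappa.
Hypothesis delta_gt0 : 0 < delta.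
Hypothesis kappa_le : kappa <= delta * m%:R.

(** A nondecreasing step function, so that the preimage of each level is an
    interval. *)
Definition cell (r : R) : 'I_m.+1 :=
  inord (minn m (Num.trunc ((r - kappa^-1) / delta))).

Definition level (k : 'I_m.+1) : R := Num.min kappa (kappa^-1 + delta * k%:R).

Lemma level_itv k : kappa^-1 <= level k <= kappa.
Proof.
rewrite /level le_min ge_min lexx /= andbT lerDl mulr_ge0 ?(ltW delta_gt0) // andbT.
by rewrite (le_trans _ kappa_ge1) // invf_le1 // (lt_le_trans ltr01).
Qed.

Lemma level_cell r : kappa^-1 <= r <= kappa -> `|level (cell r) - r| <= delta.
Proof.
move=> /andP[r0 r1]; have k0 : 0 < kappa^-1 by rewrite invr_gt0 (lt_le_trans ltr01).
set t := (r - kappa^-1) / delta.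
have tE : delta * t = r - kappa^-1 by rewrite mulrC divfK // gt_eqF.
have t0 : 0 <= t by rewrite divr_ge0 ?subr_ge0 // ltW.
have /andP[h1 h2] := truncn_itv t0.
have tm : (Num.trunc t <= m)%N.
  rewrite -(ler_nat R) (le_trans h1) // -(ler_pM2l delta_gt0) tE.
  have := kappa_le; lra.
have -> : level (cell r) = kappa^-1 + delta * (Num.trunc t)%:R.
  rewrite /level /cell -/t inordK ?ltnS ?geq_minl // (minn_idPr tm) min_r //.
  have := ler_wpM2l (ltW delta_gt0) h1; rewrite tE; lra.
have d1 := ler_wpM2l (ltW delta_gt0) h1; have d2 := ler_wpM2l (ltW delta_gt0) (ltW h2).
by rewrite -natr1 mulrDr in d2; rewrite ler_norml; apply/andP; split; lra.
Qed.

Lemma measurable_cell k : measurable (cell @^-1` [set k]).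
Proof.
apply: is_interval_measurable => x y /= xk yk z /andP[xz zy].
have mono u v : u <= v -> (cell u <= cell v)%N.
  move=> uv; rewrite /cell !inordK ?ltnS ?geq_minl //.
  rewrite leq_min geq_minl /= geq_min; apply/orP; right; apply: le_truncn.
  by rewrite ler_wpM2r ?invr_ge0 ?(ltW delta_gt0) // lerD2r.
apply/val_inj/anti_leq; apply/andP.
by split; [rewrite -yk | rewrite -xk]; exact: mono.
Qed.

End Rounding.

(** * The two bounds for the effective conductance *)

Section EdgeIndependence.
Context {disp : measure_display} {T : measurableType disp} {R : realType}.
Context (P : probability T R) (d N : nat) (a : {fset lattice d} -> {RV P >-> R}).
Hypothesis a_indep : mutually_independent (@edges d) a.

Lemma box_edges_independent (B : box_edge d N -> set R) :
  (forall i, measurable (B i)) ->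
  P (\bigcap_i (a (edge_fset i) @^-1` B i)) =
  (\prod_i P (a (edge_fset i) @^-1` B i))%E.
Proof.
move=> mB.
pose S : {fset {fset lattice d}} := [fset edge_fset i | i in {: box_edge d N}]%fset.
(* [B] as a function of the edge seen as a set; by injectivity of [edge_fset]
   the choice made by [pick] is the right one. *)
pose B' e := if [pick i | edge_fset i == e] is Some i then B i else setT.
have B'E i : B' (edge_fset i) = B i.
  rewrite /B'; case: pickP => [j /eqP/edge_fset_inj -> //|/(_ i)].
  by rewrite eqxx.
have mB' e : measurable (B' e) by rewrite /B'; case: pickP.
have SE e : e \in S <-> exists i : box_edge d N, e = edge_fset i.
  split; first by case/imfsetP => i _ ->; exists i.
  by case=> i ->; apply: in_imfset.
have := a_indep (S := S) (B := B') _ mB'.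
rewrite big_imfset /=; last by move=> i j _ _; exact: edge_fset_inj.
rewrite big_enum /= => H.
rewrite (_ : \bigcap_i _ = \bigcap_(e in [set` S]) (a e @^-1` B' e)); last first.
  apply/seteqP; split => w H'.
    by move=> _ /SE[i ->]; rewrite /= B'E; exact: H'.
  by move=> i _; rewrite -B'E; apply: H'; apply/SE; exists i.
rewrite H; first by apply: eq_bigr => i _; rewrite B'E.
by move=> _ /SE[i ->]; exact: edge_fset_edges.
Qed.

End EdgeIndependence.

Section ConductanceConcentration.
Context {R : realType} (d : nat) (hd : (3 <= d.+1)%N) (kappa : R).
Hypothesis kappa_ge1 : 1 <= kappa.
Context {disp : measure_display} {T : measurableType disp} (P : probability T R).
Context (a : {fset lattice d} -> {RV P >-> R}).
Hypothesis a_indep : mutually_independent (@edges d) a.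
Hypothesis a_bounds : forall e, edges e ->
  {ae P, forall w, kappa^-1 <= a e w <= kappa}.
Context (N : nat) (N_gt0 : (0 < N)%N).

Let S : R := N%:R `^ ((2 - d.+1%:R) / 2).
Let q : R := Num.sqrt (kappa * C0 d kappa).
(* A small fraction of the scale [q * S]: in the tail it costs a factor of
   exp(1/4), in the variance an eighth of the target. *)
Let eta : R := q * S / 8.

Lemma var_scaleE : @var_scale R d N = S ^+ 2.
Proof.
rewrite /var_scale /S -powR_mulrn ?powR_ge0 // -powRrM divfK //.
rewrite powRB ?pnatr_eq0 -?lt0n ?N_gt0 ?implybT //.
by rewrite powR_mulrn // powR_mulrn.
Qed.

Lemma powR_scale_sqr : N%:R `^ (2 - d.+1%:R) = S ^+ 2.
Proof. by rewrite /S -powR_mulrn ?powR_ge0 // -powRrM divfK. Qed.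

Let S_gt0 : 0 < S. Proof. by rewrite powR_gt0 // ltr0n. Qed.

Let S_le1 : S <= 1.
Proof.
rewrite /S -[leRHS](powRr0 N%:R) ler_powR ?ler1n //.
have : 3 <= d.+1%:R :> R by rewrite ler_nat.
lra.
Qed.

Let kC0 : kappa * C0 d kappa = 32 * d.+1%:R * kappa ^+ 4.
Proof. by rewrite /C0; ring. Qed.

Let k4 : 0 < kappa ^+ 4. Proof. by rewrite exprn_gt0 // (lt_le_trans ltr01). Qed.

Let q_sqr : q ^+ 2 = 32 * d.+1%:R * kappa ^+ 4.
Proof. by rewrite /q kC0 sqr_sqrtr // mulr_ge0 // ltW. Qed.

Let q_sqr_ge : 96 * kappa ^+ 4 <= q ^+ 2.
Proof.
rewrite q_sqr ler_wpM2r ?(ltW k4) //.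
have : 3 <= d.+1%:R :> R by rewrite ler_nat.
lra.
Qed.

Let q_ge : 8 * kappa <= q.
Proof.
have k0 : 0 <= kappa by rewrite (le_trans ler01).
rewrite -[leLHS]ger0_norm ?mulr_ge0 // -[leRHS]ger0_norm ?sqrtr_ge0 //.
rewrite -ler_sqr ?nnegrE ?normr_ge0 // !real_normK ?num_real //.
apply: le_trans q_sqr_ge.
have : kappa ^+ 2 * 1 <= kappa ^+ 2 * kappa ^+ 2.
  by rewrite ler_wpM2l ?sqr_ge0 // expr_ge1.
have -> : kappa ^+ 2 * kappa ^+ 2 = kappa ^+ 4 by ring.
by rewrite exprMn; have := ltW k4; lra.
Qed.

Let q_gt0 : 0 < q. Proof. by apply: lt_le_trans q_ge; have := kappa_ge1; lra. Qed.

(* By Lipschitz continuity, rounding with this mesh moves f by at most [eta]. *)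
Let mesh : R := eta / (N%:R ^- d.+1 * (#|{: box_edge d N}|%:R * N.+1%:R ^+ 2) + 1).

Let mesh_gt0 : 0 < mesh.
Proof.
by rewrite /mesh divr_gt0 // ?divr_gt0 ?mulr_gt0.
Qed.

Let m : nat := Num.bound (kappa / mesh).

Let kappa_le : kappa <= mesh * m%:R.
Proof.
rewrite mulrC -ler_pdivrMr //; apply/ltW/archi_boundP.
by rewrite divr_ge0 ?(ltW mesh_gt0) // (le_trans ler01).
Qed.

Let Y (i : box_edge d N) (w : T) : 'I_m.+1 := cell kappa mesh m (a (edge_fset i) w).
Let F (k : {ffun box_edge d N -> 'I_m.+1}) : R :=
  box_conductance (fun i => level kappa mesh (k i)).

Let level_elliptic (k : {ffun box_edge d N -> 'I_m.+1}) :
  elliptic kappa (fun i => level kappa mesh (k i)).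
Proof. by move=> i; exact: level_itv. Qed.

Let mY i k : measurable (Y i @^-1` [set k]).
Proof.
rewrite -[X in measurable X]setTI.
have ma : measurable_fun setT (a (edge_fset i)) by exact: measurable_funPT.
by apply: (ma measurableT (cell kappa mesh m @^-1` [set k])); exact: measurable_cell.
Qed.

Let indepY (k : {ffun box_edge d N -> 'I_m.+1}) :
  P (\bigcap_i (Y i @^-1` [set k i])) = (\prod_i P (Y i @^-1` [set k i]))%E.
Proof.
apply: (box_edges_independent a_indep
  (B := fun i => cell kappa mesh m @^-1` [set k i])) => i.
exact: measurable_cell.
Qed.

Let a_elliptic : {ae P, forall w, elliptic kappa (fun i : box_edge d N => a (edge_fset i) w)}.
Proof. by apply: filter_forall => i; exact/a_bounds/edge_fset_edges. Qed.

Let fE w : f_ a N w = box_conductance (fun i : box_edge d N => a (edge_fset i) w).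
Proof. exact: eff_conductanceE. Qed.

Let mf : measurable_fun setT (f_ a N).
Proof. by apply: measurable_eff_conductance => e; exact: measurable_funPT. Qed.

Let F_ge0 k : 0 <= F k. Proof. exact: (box_conductance_ge0 N_gt0 kappa_ge1 (level_elliptic k)). Qed.

Let f_ge0 : {ae P, forall w, 0 <= f_ a N w}.
Proof. by apply: filterS a_elliptic => w ea; rewrite fE; exact: (box_conductance_ge0 N_gt0 kappa_ge1 ea). Qed.

Let eta_gt0 : 0 < eta. Proof. by rewrite divr_gt0 // mulr_gt0. Qed.

Let fF : {ae P, forall w, `|f_ a N w - F (joint Y w)| <= eta}.
Proof.
apply: filterS a_elliptic => w ea; rewrite fE distrC.
apply: le_trans (box_conductance_lip (delta := mesh) N_gt0 kappa_ge1 ea (level_elliptic _) _) _.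
  by move=> i; rewrite ffunE; exact: level_cell.
set C := (X in X * mesh); have C0 : 0 <= C.
  by apply: mulr_ge0; rewrite ?invr_ge0 ?exprn_ge0 ?mulr_ge0.
have -> : eta = mesh * (C + 1) by rewrite /mesh divfK // gt_eqF // ltr_wpDl.
by rewrite mulrC ler_wpM2l ?(ltW mesh_gt0) // lerDl.
Qed.

Let F_incr w : exists D : box_edge d N -> R,
  (forall i l, F (upd w i l) - F w <= D i) /\
  \sum_i D i ^+ 2 <= 9 * kappa ^+ 4 * S ^+ 2.
Proof.
have [D [D1 D2]] := box_conductance_coord N_gt0 kappa_ge1 (level_elliptic w).
rewrite var_scaleE in D2; exists D; split => // i l; apply: D1; first exact: level_elliptic.
by move=> j ji; rewrite ffunE (negPf ji).
Qed.

Let F_osc w i l : F (upd w i l) - F w <= 4 * kappa * S ^+ 2.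
Proof.
rewrite -var_scaleE; apply: (@box_conductance_osc _ _ _ N_gt0 _ kappa_ge1 _ _ i) => //.
by move=> j ji; rewrite ffunE (negPf ji).
Qed.

(** Chernoff's bound at the inverse of [q * S].  The rounding costs exp(1/4), and
    8/3 * exp(1/4) is below 4. *)
Lemma conductance_tail (t : R) : 
  (P [set w | (t * S <= `|f_ a N w - fine 'E_P[f_ a N]%E|)%R] <=
   (4 * expR (- (t / q)))%:E)%E.
Proof.
apply: (le_trans (tail_transfer mY indepY mf F_ge0 f_ge0 fF (ltW eta_gt0) (t * S))).
rewrite lee_fin.
have k0 : 0 < kappa by rewrite (lt_le_trans ltr01).
have qS : 0 < q * S by rewrite mulr_gt0.
have := two_sided_tail (law_ge0 P Y) (law_sum1 P mY) F_incr F_osc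
  (lam0 := (q * S)^-1) (t * S - 2 * eta).
move=> H; apply: (le_trans (H _ _ _ _)).
- by rewrite invr_ge0 ltW.
- rewrite mulrC ler_pdivrMr //.
  have : kappa * S * S <= kappa * S * 1 by rewrite ler_wpM2l // mulr_ge0 // ltW.
  have := ler_wpM2r (ltW S_gt0) q_ge; lra.
- rewrite exprVn mulrC ler_pdivrMr ?exprn_gt0 // exprMn.
  have := ler_wpM2r (sqr_ge0 S) q_sqr_ge.
  have : 0 <= kappa ^+ 4 * S ^+ 2 by rewrite mulr_ge0 ?sqr_ge0 // ltW.
  lra.
- by rewrite mulr_ge0 ?sqr_ge0 // mulr_ge0 // ltW.
have -> : - ((q * S)^-1 * (t * S - 2 * eta)) = 4^-1 + - (t / q).
  by rewrite /eta; field; rewrite !gt_eqF.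
rewrite expRD mulrA ler_wpM2r ?expR_ge0 //.
have : expR 4^-1 <= 4 / 3 :> R.
  apply: (le_trans (expR_le_inv _)); first by lra.
  by rewrite -[leLHS]mul1r ler_pdivrMr; lra.
lra.
Qed.

(** Doubling the variance bound 9 kappa^4 N^(2-D) and adding the rounding error
    stays below 32 (d+1) kappa^4 N^(2-D), since d+1 >= 3. *)
Lemma conductance_variance : ('V_P[f_ a N] <= (kappa * C0 d kappa * S ^+ 2)%:E)%E.
Proof.
apply: (le_trans (variance_transfer mY indepY mf F_ge0 f_ge0 fF (ltW eta_gt0))).
rewrite lee_fin kC0 -q_sqr.
have := variance_bound (law_ge0 P Y) (law_sum1 P mY) F_incr.
have := ler_wpM2r (sqr_ge0 S) q_sqr_ge.
have -> : 8 * eta ^+ 2 = q ^+ 2 * S ^+ 2 / 8 by rewrite /eta; field.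
have : 0 <= kappa ^+ 4 * S ^+ 2 by rewrite mulr_ge0 ?sqr_ge0 // ltW.
lra.
Qed.

End ConductanceConcentration.

Theorem theorem2 (R : realType) (d : nat) (hd : (3 <= d.+1)%N)
    (kappa : R) (hkappa : 1 <= kappa)
    (disp : measure_display) (T : measurableType disp) (P : probability T R)
    (a : {fset lattice d} -> {RV P >-> R})
    (a_indep : mutually_independent (@edges d) a)
    (a_ident : identically_distributed (@edges d) a)
    (a_bounds : forall e, edges e ->
       {ae P, forall w, kappa^-1 <= a e w <= kappa}) :
  (forall (t : R) (N : nat), 0 <= t -> (1 <= N)%N ->
     (P [set w | (t * N%:R `^ ((2 - d.+1%:R) / 2)
                  <= `|f_ a N w - fine 'E_P[f_ a N]|)%R]
      <= (4 * expR (- (t / Num.sqrt (kappa * C0 d kappa))))%:E)%E) /\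
  (forall N : nat, (1 <= N)%N ->
     ('V_P[f_ a N] <= (kappa * C0 d kappa * N%:R `^ (2 - d.+1%:R))%:E)%E).
Proof.
split=> [t N _ N_gt0|N N_gt0].
  exact: conductance_tail.
by rewrite powR_scale_sqr; exact: conductance_variance.
Qed.
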